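(* Let $\mathsf{K}$ be a simplicial complex which is a triangulation of the $n$-dimensional sphere and whose vertices are partitioned into $n+1$ subsets $V_0,\dots,V_n$. If for every $S\subset\{0,\dots,n\}$ with $1\le |S|\le n-1$, $$\widetilde H_{|S|}(\mathsf{K}_S)=0,$$ then $\mathsf{K}$ admits a rainbow $n$-simplex, i.e. an $n$-simplex of $\mathsf{K}$ with exactly one vertex in each of $V_0,\dots,V_n$.
   Context: Homology $\widetilde H_*$ is reduced simplicial homology with coefficients in an arbitrary (fixed) field. For $S\subseteq\{0,\dots,n\}$, $\mathsf{K}_S$ denotes the subcomplex of $\mathsf{K}$ induced by the vertices in $\bigcup_{i\in S}V_i$ (all simplices of $\mathsf{K}$ whose vertices all lie in that union). *)

(* Defs.v *)
From HB Require Import structures.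
From mathcomp Require Import all_boot all_order all_algebra.
From mathcomp Require Import ring_quotient.

Set Implicit Arguments.
Unset Strict Implicit.
Unset Printing Implicit Defensive.

Import Order.TTheory GRing.Theory Num.Theory.

Local Open Scope ring_scope.

Section Complexes.
Variable T : finType.
Implicit Types (K : {set {set T}}) (U s t : {set T}).

(* The empty simplex is always a face (degree -1 in the augmented chain
   complex).  An element of [T] need not be a vertex. *)
Definition simplicial_complex K : Prop :=
  set0 \in K /\ (forall s t, s \in K -> t \subset s -> t \in K).

Definition vertices K : {set T} := [set v | [set v] \in K].

Definition induced K U : {set {set T}} := [set s in K | s \subset U].

End Complexes.

Section Homology.
Variables (F : fieldType) (T : finType).
Implicit Types (K : {set {set T}}) (s : {set T}) (k : nat).

Local Notation chain := {ffun {set T} -> F^o}.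

(* The generator of the chain space given by the simplex [s], oriented by the
   enumeration order of [T]. *)
Definition simplex s : chain := [ffun t => (t == s)%:R].

Definition face_sign s (v : T) : F :=
  (-1) ^+ #|[set w in s | (enum_rank w < enum_rank v)%N]|.

(* On a singleton this is the augmentation: [set v] is sent to the generator
   of the empty simplex, so the homology below is reduced in degree 0. *)
Definition boundary_fun (c : chain) : chain :=
  \sum_(s : {set T}) \sum_(v in s) (c s * face_sign s v) *: simplex (s :\ v).

Fact boundary_fun_is_linear : linear boundary_fun.
Proof.
move=> a c d; rewrite /boundary_fun scaler_sumr -big_split /=.
apply: eq_bigr => s _; rewrite scaler_sumr -big_split /=.
apply: eq_bigr => v _; rewrite !ffunE scalerA -scalerDl; congr (_ *: _).
by rewrite mulrDl mulrA.
Qed.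

HB.instance Definition _ :=
  GRing.isLinear.Build F chain chain *:%R boundary_fun boundary_fun_is_linear.

Definition boundary : 'End(chain) := linfun boundary_fun.

(* Chains of degree [k], i.e. supported on the faces with [k.+1] vertices. *)
Definition chains K k : {vspace chain} :=
  (\sum_(s in K | #|s| == k.+1) <[simplex s]>)%VS.

Definition cycles K k : {vspace chain} := (chains K k :&: lker boundary)%VS.

Definition boundaries K k : {vspace chain} := (boundary @: chains K k.+1)%VS.

(* The boundaries, as a subspace of the space of cycles. *)
Definition cycle_boundaries K k : {vspace subvs_of (cycles K k)} :=
  (linfun vsval @^-1: boundaries K k)%VS.

Definition reduced_homology K k : zmodType := Quotient.quot (cycle_boundaries K k).

End Homology.

(* The blocks of a partition are nonempty. *)
Definition vertex_partition (T : finType) (n : nat) (K : {set {set T}})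
    (V : 'I_n.+1 -> {set T}) : Prop :=
  [/\ forall i, V i != set0, forall i j, i != j -> [disjoint V i & V j] &
      \bigcup_i V i = vertices K].

Definition rainbow_simplex (T : finType) (n : nat) (K : {set {set T}})
    (V : 'I_n.+1 -> {set T}) (s : {set T}) : Prop :=
  [/\ s \in K, #|s| = n.+1 & forall i, #|s :&: V i| = 1%N].

From mathcomp Require Import all_classical all_reals all_analysis.
Import numFieldNormedType.Exports.

Section Realization.
Variables (R : realType) (T : finType).

Local Open Scope classical_set_scope.

(* Points are given by their barycentric coordinates; the coordinate at [v] is
   the entry of index [enum_rank v]. *)
Definition geometric_realization (K : {set {set T}}) : set 'rV[R]_#|T| :=
  [set x | [/\ forall i, 0 <= x ord0 i, \sum_i x ord0 i = 1 &
               [set v | x ord0 (enum_rank v) != 0]%SET \in K]].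

Definition unit_sphere (n : nat) : set 'rV[R]_n.+1 :=
  [set x | \sum_i x ord0 i ^+ 2 = 1].

(* The values of [f] off [A] and of [g] off [B] are irrelevant. *)
Definition homeomorphic (X Y : topologicalType) (A : set X) (B : set Y) : Prop :=
  exists f : X -> Y, exists g : Y -> X,
    [/\ {within A, continuous f} /\ {within B, continuous g},
        forall x, A x -> B (f x), forall y, B y -> A (g y),
        forall x, A x -> g (f x) = x & forall y, B y -> f (g y) = y].

Definition sphere_triangulation (n : nat) (K : {set {set T}}) : Prop :=
  simplicial_complex K /\
  homeomorphic (geometric_realization K) (@unit_sphere n).

End Realization.

(* Main.v *)
(* If there is no rainbow simplex, every simplex of K misses a colour, so K is
   the union of the subcomplexes K_S with |S| = n.  In the Mayer-Vietoris (Cech)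
   double complex of this cover, the terms contributing to H^n(K) are the groups
   H^|S|(K_S).  They vanish by hypothesis for 1 <= |S| <= n - 1, trivially for
   S empty, and for |S| = n because K_S lies in the sphere minus a vertex.  Hence
   H^n(K) = 0, which is absurd for a triangulation of the n-sphere.

   The two topological inputs come from one principle: if continuous maps
   |L| -> |M| -> |K| compose to the inclusion of L in K and H^k(M) = 0, then
   k-cocycles of K are coboundaries on L.  To prove it, simplicial cochains are
   compared, by acyclic carriers, with cochains on tuples of pairwise close points
   of the realization, which can be pulled back along uniformly continuous maps.

   All of this is done with cochains, i.e. plain functions on sequences of
   vertices; homology enters only through linear duality. *)

From mathcomp Require Import all_boot all_order all_algebra ring_quotient.
From mathcomp Require Import all_classical all_reals all_analysis.
From mathcomp Require Import ring lra zify.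
Require Import Defs.
Import numFieldNormedType.Exports.

Set Implicit Arguments.
Unset Strict Implicit.
Unset Printing Implicit Defensive.

Import Order.TTheory GRing.Theory Num.Theory.

(** * Cochains and acyclic carriers *)

(** Tuples of close points, unlike simplices, can be pushed forward by a uniformly continuous map
    without subdividing its source or approximating it simplicially. The price is that tuples lying
    in a face must be contracted without leaving their scale; this dictates the contraction by many
    small steps.

    Both uses of the principle route a complex through another whose cohomology is under control:
    the boundary of a simplex through [K], which would kill its fundamental class if [K] were
    acyclic in degree [n], and [K] minus a vertex through a full simplex, by stereographic
    projection.

    In the double complex a zigzag keeps the total degree constant: it meets a set [I] of deleted
    colours in degree [n + 1 - |I|]. This is exactly the number of remaining colours, whence the
    pairing of the degree with [|S|] in the hypothesis. *)

Section Cochains.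
Variable F : fieldType.
Local Open Scope ring_scope.

Section Coboundary.
Variable X : eqType.
Implicit Types (c d : seq X -> F) (s t u : seq X).

(* Degree is not recorded: a cochain is a function on sequences of all lengths,
   and a [k]-cochain is used only through its values on those of length [k.+1].
   The empty sequence has degree -1, so the cohomology is reduced. *)
Fixpoint cob c s : F :=
  if s is x :: t then c t - cob (fun u => c (x :: u)) t else 0.

Fixpoint faces s : seq (seq X) :=
  if s is x :: t then t :: [seq x :: u | u <- faces t] else [::].

Lemma face_size s u : u \in faces s -> size s = (size u).+1.
Proof.
elim: s u => [//|x t IH] u /=; rewrite inE => /predU1P[-> //|/mapP[v vt ->]] /=.
by rewrite (IH v).
Qed.

Lemma face_subseq s u : u \in faces s -> subseq u s.
Proof.
elim: s u => [//|x t IH] u /=; rewrite inE => /predU1P[->|/mapP[v vt ->]].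
  exact: subseq_cons.
by rewrite eqxx IH.
Qed.

Lemma eq_cob c d s : {in faces s, c =1 d} -> cob c s = cob d s.
Proof.
elim: s c d => [//|x t IH] c d cd /=; rewrite cd ?mem_head//.
rewrite (IH _ (fun u => d (x :: u)))// => u ut.
by apply: cd; rewrite inE map_f ?orbT.
Qed.

Lemma cobB c d s : cob (fun u => c u - d u) s = cob c s - cob d s.
Proof. by elim: s c d => [|x t IH] c d /=; rewrite ?IH ?subrr//; ring. Qed.

Lemma cob0 s : cob (fun=> 0) s = 0.
Proof. by elim: s => //= x t ->; rewrite subrr. Qed.

Lemma cobD c d s : cob (fun u => c u + d u) s = cob c s + cob d s.
Proof. by elim: s c d => [|x t IH] c d /=; rewrite ?IH ?addr0//; ring. Qed.

Lemma cob_sum I (r : seq I) (c : I -> seq X -> F) s :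
  cob (fun u => \sum_(i <- r) c i u) s = \sum_(i <- r) cob (c i) s.
Proof.
elim: r => [|i r IH].
  by rewrite big_nil -[RHS](cob0 s); apply: eq_cob => u _; rewrite big_nil.
by rewrite big_cons -IH -cobD; apply: eq_cob => u _; rewrite big_cons.
Qed.

Lemma cob_cob c s : cob (cob c) s = 0.
Proof.
elim: s c => [//|x t IH] c /=.
by rewrite (cobB c) IH subr0 subrr.
Qed.

Definition cocycle (P : seq X -> Prop) k c :=
  forall s, P s -> size s = k.+2 -> cob c s = 0.
Definition coboundary (P : seq X -> Prop) k c :=
  exists b, forall s, P s -> size s = k.+1 -> c s = cob b s.
Definition acyclic P k := forall c, cocycle P k c -> coboundary P k c.

End Coboundary.

Lemma cob_map (X Y : eqType) (f : X -> Y) c s :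
  cob (fun u => c (map f u)) s = cob c (map f s).
Proof. by elim: s c => //= x t IH c; rewrite -(IH (fun u => c (f x :: u))). Qed.

Lemma cobC (X Y : eqType) (x : seq X -> seq Y -> F) I s :
  cob (fun J => cob (x J) s) I = cob (fun u => cob (x^~ u) I) s.
Proof.
elim: I x => /= [|i I IH] x; first by rewrite cob0.
by rewrite cobB (IH (fun J => x (i :: J))).
Qed.

Section Carrier.
Variables (X Y : eqType) (P : seq X -> Prop) (C : seq X -> seq Y -> Prop).
Variable h : seq X -> (seq Y -> F) -> seq Y -> F.

(* The carrier [C s] of a simplex [s] is a complex of which [h s] is a cochain
   contraction. *)
Record contractible_carrier : Prop := ContractibleCarrier {
  carrier_face : forall s u, P s -> u \in faces s -> P u;
  carrier_mono : forall s u t, P s -> u \in faces s -> C u t -> C s t;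
  carrier_nil : forall s, P s -> C s [::];
  contraction_local : forall s c d t, P s -> s != [::] -> C s t ->
    (forall u, C s u -> size u = (size t).+1 -> c u = d u) ->
    h s c t = h s d t;
  contractionB : forall s c d t,
    h s (fun u => c u - d u) t = h s c t - h s d t;
  contractionP : forall s c t, P s -> s != [::] -> C s t ->
    cob (h s c) t + h s (cob c) t = c t }.

(* An operator on cochains is the transpose of a map sending each simplex to a
   chain; it is carried by [C] when the chain assigned to [s] lies in [C s]. *)
Definition carried (A : (seq Y -> F) -> seq X -> F) :=
  forall c d s, P s -> (forall t, C s t -> size t = size s -> c t = d t) ->
  A c s = A d s.

Definition cochain_map (A : (seq Y -> F) -> seq X -> F) :=
  (forall c d s, P s -> A (fun u => c u - d u) s = A c s - A d s) /\
  (forall c s, P s -> A (cob c) s = cob (A c) s).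

(** Transpose of the usual recursion of the acyclic carrier theorem: a simplex goes to the
    contraction, in its carrier, of the image of its boundary, and the empty simplex to itself. The
    fuel is the length, since faces are not structural subterms. *)
Fixpoint carrier_rec n (c : seq Y -> F) (s : seq X) : F :=
  if n is n'.+1 then cob (carrier_rec n' (h s c)) s else c [::].

Definition carrier_map c s := carrier_rec (size s) c s.

Lemma carrier_mapE c s : s != [::] ->
  carrier_map c s = cob (carrier_map (h s c)) s.
Proof.
case: s => // x s _.
rewrite -[LHS]/(cob (carrier_rec (size s) (h (x :: s) c)) (x :: s)).
by apply: eq_cob => u /face_size[/= ->].
Qed.

Hypothesis Ch : contractible_carrier.

Lemma carrier_map_carried : carried carrier_map.
Proof.
move=> c d s; have [n] := ubnP (size s).
elim: n s c d => // n IH s c d sn Ps cd.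
have [s0|sN] := eqVneq s [::].
  by move: Ps cd; rewrite s0 /carrier_map /= => Ps ->//; apply: carrier_nil Ch _ Ps.
rewrite !carrier_mapE//; apply: eq_cob => u us; apply: IH.
- by move: sn; rewrite (face_size us).
- exact: carrier_face Ch _ _ Ps us.
move=> t Cut tu; apply: (contraction_local Ch) => //.
  exact: carrier_mono Ch _ _ _ Ps us Cut.
by move=> v Csv vt; apply: cd => //; rewrite vt tu (face_size us).
Qed.

Lemma carrier_mapB c d s : P s ->
  carrier_map (fun u => c u - d u) s = carrier_map c s - carrier_map d s.
Proof.
have [n] := ubnP (size s); elim: n s c d => // n IH s c d sn Ps.
have [->//|sN] := eqVneq s [::].
rewrite !carrier_mapE// -cobB; apply: eq_cob => u us.
have Pu := carrier_face Ch Ps us.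
rewrite -IH//; last by move: sn; rewrite (face_size us).
by apply: carrier_map_carried => // t _ _; rewrite (contractionB Ch).
Qed.

(** By induction the map commutes with [cob] on faces of [s]; there [contractionP] trades
    [h s (cob c)] for [c - cob (h s c)], and the extra term is a double coboundary. *)
Lemma carrier_map_cob c s : P s -> carrier_map (cob c) s = cob (carrier_map c) s.
Proof.
have [n] := ubnP (size s); elim: n s c => // n IH s c sn Ps.
have [->//|sN] := eqVneq s [::].
rewrite carrier_mapE// -[RHS]subr0 -(cob_cob (carrier_map (h s c)) s) -cobB.
apply: eq_cob => u us; have Pu := carrier_face Ch Ps us.
rewrite -IH//; last by move: sn; rewrite (face_size us).
rewrite -carrier_mapB//; apply: carrier_map_carried => // t Cut _.
have Cst := carrier_mono Ch Ps us Cut.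
by rewrite -(contractionP Ch c Ps sN Cst) addrAC subrr add0r.
Qed.

Lemma carrier_map_cochain_map : cochain_map carrier_map.
Proof. by split=> *; [apply: carrier_mapB|apply: carrier_map_cob]. Qed.

(** Used with [A] a difference of two cochain maps that share a carrier, typically the identity and
    a composite: they then agree on cohomology. Since the homotopy is carried too, [c] only has to
    be closed on the carriers of [k]-simplices. *)
Lemma carried_nullhomotopic A k c : carried A -> cochain_map A ->
  (forall d, P [::] -> A d [::] = 0) ->
  (forall s t, P s -> C s t -> size s = k.+1 -> size t = k.+2 -> cob c t = 0) ->
  coboundary P k (A c).
Proof.
move=> Aloc [AB Acob] A0 cc.
(* Transpose of the recursion [D s = h_s (A s - D (boundary of s))], again with the length as
   fuel. *)
pose fix H n c s {struct n} := A (h s c) s - if n is n'.+1 then cob (H n' (h s c)) s else 0.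
pose H' c s := H (size s) c s.
have H'nil d : P [::] -> H' d [::] = 0 by move=> P0; rewrite /H' /= A0// subr0.
have H'E d s : H' d s = A (h s d) s - cob (H' (h s d)) s.
  case: s => [|x s]; first by rewrite /H' /=.
  rewrite -[LHS]/(_ - cob (H (size s) (h (x :: s) d)) (x :: s)); congr (_ - _).
  by apply: eq_cob => u /face_size[/= ->].
have Hloc d e s : P s ->
    (forall t, C s t -> size t = (size s).+1 -> d t = e t) -> H' d s = H' e s.
  have [n] := ubnP (size s); elim: n s d e => // n IH s d e sn Ps de.
  have [s0|sN] := eqVneq s [::]; first by rewrite s0 !H'nil -?s0.
  rewrite !H'E; congr (_ - _).
    apply: Aloc => // t Ct ts; apply: (contraction_local Ch) => // u Cu us.
    by apply: de; rewrite // us ts.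
  apply: eq_cob => u us; have Pu := carrier_face Ch Ps us.
  apply: IH => //; first by move: sn; rewrite (face_size us).
  move=> t Ct ts; have Cst := carrier_mono Ch Ps us Ct.
  apply: (contraction_local Ch) => // v Cv vt; apply: de => //.
  by rewrite vt ts (face_size us).
have HB d e s : P s -> H' (fun t => d t - e t) s = H' d s - H' e s.
  have [n] := ubnP (size s); elim: n s d e => // n IH s d e sn Ps.
  have [s0|sN] := eqVneq s [::]; first by rewrite s0 !H'nil -?s0// subrr.
  rewrite !H'E (Aloc _ (fun t => h s d t - h s e t))//; last first.
    by move=> t _ _; rewrite (contractionB Ch).
  rewrite AB//.
  suff -> : cob (H' (h s (fun t => d t - e t))) s =
      cob (H' (h s d)) s - cob (H' (h s e)) s by ring.
  rewrite -cobB; apply: eq_cob => u us; have Pu := carrier_face Ch Ps us.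
  rewrite -IH//; last by move: sn; rewrite (face_size us).
  by apply: Hloc => // t _ _; rewrite (contractionB Ch).
have HP d s : P s -> cob (H' d) s + H' (cob d) s = A d s.
  have [n] := ubnP (size s); elim: n s d => // n IH s d sn Ps.
  have [s0|sN] := eqVneq s [::]; first by move: Ps; rewrite s0 => P0; rewrite H'nil// A0//= add0r.
  rewrite H'E (Aloc _ (fun t => d t - cob (h s d) t)) => //; last first.
    by move=> t Ct _; rewrite -(contractionP Ch d Ps sN Ct); ring.
  rewrite AB// Acob//.
  have -> : cob (H' (h s (cob d))) s =
      cob (fun u => H' d u - (A (h s d) u - cob (H' (h s d)) u)) s.
    apply: eq_cob => u us; have Pu := carrier_face Ch Ps us.
    rewrite -(IH u (h s d))//; last by move: sn; rewrite (face_size us).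
    rewrite [cob _ u + _]addrC addrK -HB//; apply: Hloc => // t Ct _.
    have Cst := carrier_mono Ch Ps us Ct.
    by rewrite -(contractionP Ch d Ps sN Cst); ring.
  by rewrite !cobB cob_cob; ring.
exists (H' c) => s Ps sk; rewrite -HP// (Hloc _ (fun=> 0))//; last first.
  by move=> t Ct ts; rewrite (cc s)// ts sk.
have -> : H' (fun=> 0) s = H' (fun=> 0 - 0) s.
  by apply: Hloc => // t _ _; rewrite subrr.
by rewrite HB// subrr addr0.
Qed.

End Carrier.

Definition cone (Y : eqType) p (c : seq Y -> F) t := c (p :: t).

Lemma coneP (Y : eqType) (p : Y) c t :
  cob (cone p c) t + cone p (cob c) t = c t.
Proof. by rewrite {2}/cone /= addrC subrK. Qed.

Section SimplexCarrier.
Variables (X : eqType) (P : seq X -> Prop).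
Hypothesis Pface : forall s u, P s -> u \in faces s -> P u.

Definition simplex_contraction (s : seq X) c t :=
  if s is p :: _ then cone p c t else 0 : F.

Lemma simplex_carrier :
  contractible_carrier P (fun s t => {subset t <= s}) simplex_contraction.
Proof.
split=> //.
- by move=> s u t _ /face_subseq/mem_subseq us tu x /tu/us.
- case=> // p s c d t _ _ ts cd; apply: cd => // x.
  by rewrite inE => /predU1P[->|/ts//]; rewrite mem_head.
- by case=> [|p s] c d t; rewrite /= ?subrr.
- by case=> // p s c t _ _ _; exact: coneP.
Qed.

End SimplexCarrier.

(** * Increasing sequences against arbitrary sequences of vertices *)

Section SortedCarrier.
Variables (X : eqType) (rank : X -> nat).
Hypothesis rank_inj : injective rank.

Definition increasing (s : seq X) := sorted (fun x y => rank x < rank y)%N s.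

Lemma increasing_face s u : increasing s -> u \in faces s -> increasing u.
Proof.
move=> ss /face_subseq us; apply: subseq_sorted us ss => y x z; exact: ltn_trans.
Qed.

Lemma increasing_uniq s : increasing s -> uniq s.
Proof.
apply: sorted_uniq => [y x z|x]; [exact: ltn_trans|exact: ltnn].
Qed.

(* The cone with apex [p] over an increasing sequence of entries not below [p]:
   degenerate simplices are dropped. *)
Definition increasing_cone p (c : seq X -> F) t :=
  if ohead t == Some p then 0 else c (p :: t).

Lemma increasing_coneP p c t : p \notin behead t ->
  cob (increasing_cone p c) t + increasing_cone p (cob c) t = c t.
Proof.
have nohead u : p \notin u -> ohead u == Some p = false.
  by case: u => //= x u; rewrite inE negb_or eq_sym => /andP[/negPf + _].
case: t => [|x t] /= pt; first by rewrite {1}/increasing_cone /= add0r subr0.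
have [xp|xp] := eqVneq x p; last first.
  have pxt : p \notin x :: t by rewrite inE negb_or eq_sym xp.
  rewrite -[X in X + _]/(cob (increasing_cone p c) (x :: t)).
  rewrite -[RHS](coneP p c (x :: t)) /increasing_cone nohead//; congr (_ + _).
  apply: eq_cob => u /face_subseq/mem_subseq us.
  by rewrite nohead//; apply: contraNN pxt => /us.
rewrite /increasing_cone /= xp !eqxx addr0 -[RHS]subr0; congr (_ - _).
  by rewrite nohead.
exact: cob0.
Qed.

Lemma increasing_apex p t : increasing t -> {in t, forall x, rank p <= rank x}%N ->
  p \notin behead t /\ (ohead t != Some p -> increasing (p :: t)).
Proof.
case: t => [//|x t] /= xt pt; split.
  apply/negP => pin.
  have /allP/(_ _ pin) := order_path_min (fun _ _ _ => @ltn_trans _ _ _) xt.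
  by rewrite ltnNge pt ?mem_head.
move=> xp; apply/andP; split=> //.
rewrite ltn_neqAle pt ?mem_head// andbT; apply: contraNneq xp => /rank_inj->//.
Qed.

Definition rank_sort := sort (fun x y => rank x <= rank y)%N.

Lemma rank_sort_min p s u : rank_sort s = p :: u ->
  p \in s /\ {in s, forall x, rank p <= rank x}%N.
Proof.
move=> ssu; have sp : perm_eq (p :: u) s by rewrite -ssu perm_sort.
split=> [|x]; rewrite -(perm_mem sp) ?mem_head// inE => /predU1P[->//|].
have : sorted (fun x y => rank x <= rank y)%N (p :: u).
  by rewrite -ssu sort_sorted// => y z; exact: leq_total.
by move/(order_path_min (fun _ _ _ => @leq_trans _ _ _))/allP; apply.
Qed.

Lemma increasing_rank_sort s : uniq s -> increasing (rank_sort s).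
Proof.
move=> us; rewrite /increasing.
have : sorted (fun x y => rank x <= rank y)%N (rank_sort s).
  by apply: sort_sorted => y z; exact: leq_total.
have : uniq (rank_sort s) by rewrite sort_uniq.
case: (rank_sort s) => //= x t; elim: t x => //= y t IH x.
rewrite inE negb_or => /andP[/andP[xy xt] yt] /andP[xley yp].
rewrite ltn_neqAle xley IH ?andbT//.
by apply: contraNneq xy => /rank_inj ->.
Qed.

Variable P : seq X -> Prop.
Hypothesis Pface : forall s u, P s -> u \in faces s -> P u.

Definition increasing_contraction (s : seq X) c t :=
  if rank_sort s is p :: _ then increasing_cone p c t else 0.

Lemma increasing_carrier :
  contractible_carrier P (fun s t => increasing t /\ {subset t <= s})
    increasing_contraction.
Proof.
split=> //.
- move=> s u t _ /face_subseq/mem_subseq us [ti tu]; by split=> // x /tu/us.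
- move=> s c d t _ _ [ti ts] cd; rewrite /increasing_contraction.
  case ssE: (rank_sort s) => [//|p u]; have [ps pmin] := rank_sort_min ssE.
  rewrite /increasing_cone; case: ifPn => // tp; apply: cd => //; split.
    by apply: (increasing_apex ti _).2 => // x /ts/pmin.
  by move=> x; rewrite inE => /predU1P[->|/ts].
- move=> s c d t; rewrite /increasing_contraction.
  case: (rank_sort s) => [|p u]; first by rewrite subrr.
  by rewrite /increasing_cone; case: ifP; rewrite ?subrr.
- move=> s c t _ s0 [ti ts]; rewrite /increasing_contraction.
  case ssE: (rank_sort s) => [|p u].
    by case: s ssE s0 {ts} => // x s /(congr1 size); rewrite size_sort.
  have [ps pmin] := rank_sort_min ssE; apply: increasing_coneP.
  by apply: (increasing_apex ti _).1 => // x /ts/pmin.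
Qed.

End SortedCarrier.

(** Increasing sequences match the oriented simplices of homology; arbitrary ones can be pulled back
    along maps that ignore the order. [Q] sends a sequence to a chain of increasing sequences on the
    same vertices, and its difference with the identity is null-homotopic on both sides. *)
Lemma acyclic_increasing (X : eqType) (rank : X -> nat) (P : seq X -> Prop) k :
  injective rank -> (forall s t, P s -> {subset t <= s} -> P t) ->
  acyclic (fun s => P s /\ increasing rank s) k <-> acyclic P k.
Proof.
move=> rank_inj Psub.
have Pface s u : P s -> u \in faces s -> P u.
  by move=> Ps /face_subseq/mem_subseq; exact: Psub.
have simplexC := simplex_carrier Pface.
have incC := increasing_carrier rank_inj Pface.
have PJface s u : P s /\ increasing rank s -> u \in faces s ->
    P u /\ increasing rank u.
  by move=> [Ps si] us; split; [exact: Pface us|exact: increasing_face us].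
pose Q := carrier_map (increasing_contraction rank).
have [QB Qcob] := carrier_map_cochain_map incC.
have Qloc := carrier_map_carried incC.
split=> acyc c cc.
  have [b bP] : coboundary (fun s => P s /\ increasing rank s) k c.
    by apply: acyc => s [Ps _]; exact: cc.
  have [e eP] : coboundary P k (fun s => c s - Q c s).
    apply: (carried_nullhomotopic simplexC (A := fun c s => c s - Q c s)).
    - move=> d d' s Ps dd'; rewrite dd'//; congr (_ - _).
      by apply: Qloc => // t [_ ts] tk; apply: dd'.
    - split=> [d d' s Ps|d s Ps]; first by rewrite /= /Q QB//; ring.
      by rewrite cobB /Q Qcob.
    - by move=> d _; rewrite subrr.
    - by move=> s t Ps ts _ tk; apply: cc => //; exact: Psub ts.
  exists (fun s => e s + Q b s) => s Ps sk.
  rewrite cobD -eP// -Qcob// (Qloc (cob b) c)// ?subrK//.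
  by move=> t [ti ts] tk; rewrite -bP// ?tk//; split=> //; exact: Psub ts.
have [b bP] : coboundary P k (Q c).
  apply: acyc => s Ps sk; rewrite -Qcob// (Qloc _ (fun=> 0 - 0))//.
    by rewrite QB// subrr.
  move=> t [ti ts] tk; rewrite subrr cc ?tk//; split=> //; exact: Psub ts.
have [e eP] : coboundary (fun s => P s /\ increasing rank s) k (fun s => c s - Q c s).
  have incC' : contractible_carrier (fun s => P s /\ increasing rank s)
      (fun s t => increasing rank t /\ {subset t <= s}) (increasing_contraction rank).
    split=> //; first by move=> s u t [Ps _]; exact: (carrier_mono incC).
    - by move=> s c' d t [Ps _]; exact: (contraction_local incC).
    - exact: (contractionB incC).
    - by move=> s c' t [Ps _]; exact: (contractionP incC).
  apply: (carried_nullhomotopic incC' (A := fun c s => c s - Q c s)).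
  - move=> d d' s [Ps si] dd'; have -> : d s = d' s by apply: dd' => //; split.
    by congr (_ - _); exact: Qloc.
  - split=> [d d' s [Ps _]|d s [Ps _]]; first by rewrite /= /Q QB//; ring.
    by rewrite cobB /Q Qcob.
  - by move=> d _; rewrite subrr.
  - move=> s t [Ps _] [ti ts] _ tk; apply: cc => //; split=> //; exact: Psub ts.
exists (fun s => e s + b s) => s Ps sk.
by rewrite cobD -eP// -bP ?subrK//; case: Ps.
Qed.

Section Prism.
Variables (X Y : eqType).
Implicit Types (f g : X -> Y) (c d : seq Y -> F).

(** The classical prism operator, the alternating sum of [c] over
    [f x_0, ..., f x_i, g x_i, ..., g x_k]. Only points of the two images occur, so no interpolation
    between [f] and [g] is involved. *)
Fixpoint prism f g c s : F :=
  if s is x :: t then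
    c (f x :: g x :: map g t) - prism f g (fun u => c (f x :: u)) t
  else 0.

Lemma prismB f g c d s :
  prism f g (fun u => c u - d u) s = prism f g c s - prism f g d s.
Proof.
elim: s c d => [|x t IH] c d /=; rewrite ?subrr//.
by rewrite (IH (fun u => c (f x :: u))); ring.
Qed.

Lemma prism_local f g c d s :
  (forall u, {subset u <= map f s ++ map g s} -> size u = (size s).+1 ->
    c u = d u) -> prism f g c s = prism f g d s.
Proof.
elim: s c d => [//|x t IH] c d cd /=; congr (_ - _).
  apply: cd => [u|]; last by rewrite /= size_map.
  rewrite !inE !mem_cat !inE => /or3P[->//|->|->]; rewrite ?orbT//.
apply: IH => u us ut; apply: cd => [y|]; last by rewrite /= ut.
rewrite !inE => /predU1P[->|/us]; rewrite ?eqxx//.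
by rewrite !mem_cat inE => /orP[->|->]; rewrite ?orbT.
Qed.

Lemma prismP f g c s :
  cob (prism f g c) s + prism f g (cob c) s = c (map g s) - c (map f s).
Proof.
elim: s c => [|x t IH] c /=; first by rewrite addr0 subrr.
rewrite cobB (cob_map g (fun u => c (f x :: g x :: u))) prismB.
have := IH (fun u => c (f x :: u)).
set a := cob (prism _ _ _) _; set b := prism _ _ (cob _) _ => ab.
rewrite (_ : a = c (f x :: map g t) - c (f x :: map f t) - b); last first.
  by rewrite -ab addrK.
by ring.
Qed.

End Prism.

End Cochains.

(** * Rips complexes of a realization *)

Section Points.
Variables (R : realType) (T : finType).
Local Open Scope ring_scope.
Implicit Types (x y : 'rV[R]_#|T|) (U : {set T}).

Definition bcoord x v := x ord0 (enum_rank v).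
Definition bpoint (f : T -> R) : 'rV[R]_#|T| := \row_i f (enum_val i).

Lemma bcoord_point f v : bcoord (bpoint f) v = f v.
Proof. by rewrite /bcoord mxE enum_rankK. Qed.

Lemma bcoordP x y : bcoord x =1 bcoord y -> x = y.
Proof. by move=> xy; apply/rowP => i; rewrite -[i]enum_valK; apply: xy. Qed.

Lemma sum_bcoord x : \sum_i x ord0 i = \sum_v bcoord x v.
Proof.
rewrite (reindex (@enum_rank T)) //.
by exists (@enum_val T T) => ? _; rewrite ?enum_rankK ?enum_valK.
Qed.

Definition supp x := [set v | bcoord x v != 0].

Lemma supp0 x v : v \notin supp x -> bcoord x v = 0.
Proof. by rewrite inE negbK => /eqP. Qed.

Definition eclose (e : R) x y := forall v, `|bcoord x v - bcoord y v| <= e.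

(* Barycentric coordinates are not normalised: the maximum of a point with a
   multiple of the indicator of a face is then admissible again.  This operation
   does not increase distances, so it contracts the Rips complex of a face. *)
Definition admissible x :=
  (forall v, 0 <= bcoord x v <= 1) /\ 2^-1 <= \sum_v bcoord x v.

Definition rips (e : R) U (s : seq 'rV[R]_#|T|) :=
  (forall x, x \in s -> admissible x /\ supp x \subset U) /\
  (forall x y, x \in s -> y \in s -> eclose e x y).

Lemma rips_sub e U s t : rips e U s -> {subset t <= s} -> rips e U t.
Proof. by move=> [sU se] ts; split=> [x /ts|x y /ts xs /ts]; [exact: sU|exact: se]. Qed.

Lemma rips_nil e U : rips e U [::].
Proof. by split. Qed.

Definition inflate U (a : R) x :=
  bpoint (fun v => Num.max (bcoord x v) (if v \in U then a else 0)).

Lemma admissible_inflate U a x : admissible x -> 0 <= a <= 1 ->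
  admissible (inflate U a x).
Proof.
move=> [x01 xs] a01; split=> [v|].
  rewrite bcoord_point; case/andP: (x01 v) => x0 x1.
  by rewrite le_max x0 ge_max x1; case: ifP => _; rewrite ?ler01//; case/andP: a01.
apply: le_trans xs _; apply: ler_sum => v _.
by rewrite bcoord_point le_max lexx.
Qed.

Lemma supp_inflate U a x : supp x \subset U -> supp (inflate U a x) \subset U.
Proof.
move=> xU; apply/fintype.subsetP => v; apply: contraTT => vU.
rewrite inE negbK bcoord_point (negPf vU) supp0 ?maxxx//.
by apply: contra vU => /(fintype.subsetP xU).
Qed.

Lemma max_lipschitz (e a b c d : R) : `|a - b| <= e -> `|c - d| <= e ->
  `|Num.max a c - Num.max b d| <= e.
Proof.
rewrite !ler_distl => /andP[? ?] /andP[? ?].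
by case: (leP a c) => ?; case: (leP b d) => ?; apply/andP; split; lra.
Qed.

Lemma close_inflate e U a b x y : 0 <= e -> eclose e x y -> `|a - b| <= e ->
  eclose e (inflate U a x) (inflate U b y).
Proof.
move=> e0 xy ab v; rewrite !bcoord_point; apply: max_lipschitz => //.
by case: ifP; rewrite // subrr normr0.
Qed.

Lemma inflate0 U x : admissible x -> supp x \subset U -> inflate U 0 x = x.
Proof.
move=> [x01 _] xU; apply: bcoordP => v; rewrite bcoord_point if_same.
by apply/max_idPl; case/andP: (x01 v).
Qed.

(** Unnormalised, with all coordinates on [U] equal to one: this is the common end point of all
    inflations in [U]. *)
Definition barycenter U := bpoint (fun v => (v \in U)%:R).

Lemma inflate1 U x : admissible x -> supp x \subset U ->
  inflate U 1 x = barycenter U.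
Proof.
move=> [x01 _] xU; apply: bcoordP => v; rewrite !bcoord_point.
case: ifPn => vU; first by apply/max_idPr; case/andP: (x01 v).
by rewrite supp0 ?maxxx//; apply: contra vU => /(fintype.subsetP xU).
Qed.

Lemma admissible_barycenter U : U != finset.set0 -> admissible (barycenter U).
Proof.
case/finset.set0Pn => u uU; split=> [v|].
  by rewrite bcoord_point; case: (v \in U); rewrite ?lexx ?ler01.
rewrite (bigD1 u)//= bcoord_point uU mulr1n.
have : 0 <= \sum_(i | i != u) bcoord (barycenter U) i.
  by apply: sumr_ge0 => v _; rewrite bcoord_point ler0n.
by move: (\sum_(i | _) _) => S; lra.
Qed.

Lemma supp_barycenter U : supp (barycenter U) \subset U.
Proof.
apply/fintype.subsetP => v; apply: contraTT => vU.
by rewrite inE negbK bcoord_point (negPf vU).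
Qed.

Section RipsCarrier.
Variables (F : fieldType) (m : nat) (e : R).
Hypotheses (m0 : (0 < m)%N) (me : m%:R^-1 <= e).

Let step j : R := j%:R / m%:R.

Let step01 j : (j <= m)%N -> 0 <= step j <= 1.
Proof.
move=> jm; rewrite /step divr_ge0//=.
by rewrite ler_pdivrMr ?ltr0n// mul1r ler_nat.
Qed.

(** Inflation from level 0, the identity, to level 1, a constant map, is cut into [m] steps of
    height [1/m]; each step is a prism, and a cone disposes of the constant map. *)
Definition rips_contraction U (c : seq 'rV[R]_#|T| -> F) s :=
  cone (barycenter U) (fun t => c t) (map (inflate U 1) s) -
  \sum_(j < m) prism (inflate U (step j)) (inflate U (step j.+1)) c s.

(** The maximum is 1-Lipschitz for the sup norm of its pair of arguments, so the distance of the
    points and the height of a step do not add up, and the scale [e] is kept. *)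
Lemma rips_inflate U s (j : 'I_m) : rips e U s ->
  rips e U (map (inflate U (step j)) s ++ map (inflate U (step j.+1)) s).
Proof.
have e0 : 0 <= e by apply: le_trans me; rewrite invr_ge0.
have jm : (j <= m)%N by apply: ltnW.
move=> [sU se].
have memE x : x \in map (inflate U (step j)) s ++ map (inflate U (step j.+1)) s ->
    exists2 y, y \in s & exists2 k, (j <= k <= j.+1)%N & x = inflate U (step k) y.
  rewrite mem_cat => /orP[] /mapP[y ys ->]; exists y => //.
    by exists j => //; rewrite leqnn leqnSn.
  by exists j.+1 => //; rewrite leqnn leqnSn.
split=> [x /memE[y ys [k jk ->]]|x x' /memE[y ys [k jk ->]] /memE[y' ys' [k' jk' ->]]].
  have [ya yU] := sU _ ys; split; last exact: supp_inflate.
  by apply: admissible_inflate => //; apply: step01; case/andP: jk => _ /leq_trans; apply.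
apply: close_inflate => //; first exact: se.
apply: le_trans me; rewrite /step -mulrBl normrM [X in _ * X]ger0_norm ?invr_ge0// -[leRHS]mul1r.
rewrite ler_wpM2r ?invr_ge0//.
have /orP[/eqP->|/eqP->] : (k == j) || (k == j.+1) by lia.
  have /orP[/eqP->|/eqP->] : (k' == j) || (k' == j.+1) by lia.
    by rewrite subrr normr0 ler01.
  by rewrite -natr1 opprD addrA subrr add0r normrN normr1.
have /orP[/eqP->|/eqP->] : (k' == j) || (k' == j.+1) by lia.
  by rewrite -natr1 addrAC subrr add0r normr1.
by rewrite subrr normr0 ler01.
Qed.

Variables (X : eqType) (P : seq X -> Prop) (hull : seq X -> {set T}).
Hypothesis Pface : forall s u, P s -> u \in faces s -> P u.
Hypothesis hull_mono : forall s u, P s -> u \in faces s -> hull u \subset hull s.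
Hypothesis hullN0 : forall s, P s -> s != [::] -> hull s != finset.set0.

Lemma rips_carrier : contractible_carrier P (fun s t => rips e (hull s) t)
  (fun s => rips_contraction (hull s)).
Proof.
have e0 : 0 <= e by apply: le_trans me; rewrite invr_ge0.
split=> //.
- move=> s u t Ps us [tU te]; split=> // x /tU[xa xu]; split=> //.
  exact: fintype.subset_trans xu (hull_mono Ps us).
- move=> s c d t Ps sN tC cd; congr (_ - _).
    apply: cd; last by rewrite /= size_map.
    suff -> : map (inflate (hull s) 1) t = nseq (size t) (barycenter (hull s)).
      rewrite -[_ :: _]/(nseq (size t).+1 (barycenter (hull s))).
      split=> [x|x y].
        rewrite mem_nseq => /andP[_ /eqP->]; split; last exact: supp_barycenter.
        exact/admissible_barycenter/hullN0.
      rewrite !mem_nseq => /andP[_ /eqP->] /andP[_ /eqP->] v.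
      by rewrite subrr normr0.
    have : {in t, forall x, inflate (hull s) 1 x = barycenter (hull s)}.
      by move=> x /tC.1[xa xU]; exact: inflate1.
    elim: t {tC} => //= x t IH xt; rewrite xt ?mem_head// IH// => y yt.
    by apply: xt; rewrite inE yt orbT.
  apply: eq_bigr => j _; apply: prism_local => u us ut; apply: cd => //.
  exact: rips_sub (rips_inflate j tC) us.
- move=> s c d t; rewrite /rips_contraction.
  rewrite (eq_bigr _ (fun j _ => prismB _ _ c d t)) sumrB /cone; ring.
move=> s c t Ps sN tC; rewrite /rips_contraction.
rewrite cobB cob_sum (cob_map (inflate (hull s) 1) (cone (barycenter (hull s)) c)).
set f1 := inflate _ 1; set b := barycenter _.
have pr (j : 'I_m) : prism (inflate (hull s) (step j)) (inflate (hull s) (step j.+1)) (cob c) t =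
    c (map (inflate (hull s) (step j.+1)) t) - c (map (inflate (hull s) (step j)) t)
    - cob (prism (inflate (hull s) (step j)) (inflate (hull s) (step j.+1)) c) t.
  by rewrite -prismP; ring.
rewrite (eq_bigr _ (fun j _ => pr j)) sumrB -[cone b c]/(cone b c).
(* The end values of the prisms telescope to the difference of levels 1 and 0. *)
have -> : \sum_(j < m) (c (map (inflate (hull s) (step j.+1)) t) -
     c (map (inflate (hull s) (step j)) t)) = c (map f1 t) - c t.
  rewrite -(big_mkord xpredT (fun j => c (map (inflate (hull s) (step j.+1)) t) -
     c (map (inflate (hull s) (step j)) t))).
  rewrite telescope_sumr// /step divff ?pnatr_eq0 -?lt0n// mul0r; congr (_ - c _).
  by rewrite map_id_in// => x /tC.1[xa xU]; exact: inflate0.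
have cancel (p q r a S : F) : p + q = r -> p - S + (q - (r - a - S)) = a.
  by move=> <-; ring.
exact/cancel/coneP.
Qed.

End RipsCarrier.

End Points.

Section RipsComplex.
Variables (F : fieldType) (R : realType) (T : finType) (K : {set {set T}}).
Hypothesis complexK : simplicial_complex K.
Local Open Scope ring_scope.

Definition simplices (s : seq T) : Prop := [set x in s] \in K.

Lemma simplices_sub s t : simplices s -> {subset t <= s} -> simplices t.
Proof.
move=> sK ts; apply: complexK.2 sK _; apply/fintype.subsetP => x.
by rewrite !inE => /ts.
Qed.

Lemma simplices_face s u : simplices s -> u \in faces s -> simplices u.
Proof. by move=> sK /face_subseq/mem_subseq; exact: simplices_sub. Qed.

Definition hull (s : seq 'rV[R]_#|T|) : {set T} := \bigcup_(x <- s) supp x.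

Lemma supp_hull s x : x \in s -> supp x \subset hull s.
Proof. by move=> xs; rewrite /hull (big_rem x)//= finset.subsetUl. Qed.

Lemma hull_subset s (U : {set T}) :
  (forall x, x \in s -> supp x \subset U) -> hull s \subset U.
Proof.
move=> sU; rewrite /hull big_seq; elim/big_ind: _ => [|A B AU BU|x /sU//].
  exact: finset.sub0set.
by rewrite finset.subUset AU.
Qed.

Lemma hull_mono s t : {subset t <= s} -> hull t \subset hull s.
Proof. by move=> ts; apply: hull_subset => x /ts; exact: supp_hull. Qed.

(** Closeness alone would not do: the entries must also share a simplex of [K], so that each tuple
    has a contractible carrier. *)
Definition rips_complex e s := hull s \in K /\ rips e (hull s) s.

Lemma rips_complex_sub e s t :
  rips_complex e s -> {subset t <= s} -> rips_complex e t.
Proof.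
move=> [sK [sU se]] ts; split; first exact: complexK.2 sK (hull_mono ts).
split=> [x xt|x y /ts + /ts]; last exact: se.
by split; [case: (sU x (ts _ xt))|exact: supp_hull].
Qed.

Lemma rips_in_complex e (U : {set T}) s : U \in K -> rips e U s ->
  rips_complex e s.
Proof.
move=> UK [sU se]; split.
  by apply: complexK.2 UK _; apply: hull_subset => x /sU[].
by split=> // x xs; split; [case: (sU x xs)|exact: supp_hull].
Qed.

Lemma admissible_supp (x : 'rV[R]_#|T|) : admissible x -> supp x != finset.set0.
Proof.
move=> [_ xs]; apply/negP => /eqP x0; move: xs.
rewrite big1 ?invr_le0 ?lern0// => v _.
by apply/supp0; rewrite x0 inE.
Qed.

Definition select v0 (x : 'rV[R]_#|T|) := odflt v0 [pick v in supp x].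

Lemma selectP v0 x : admissible x -> select v0 x \in supp x.
Proof.
move=> /admissible_supp/finset.set0Pn[v vx]; rewrite /select.
by case: pickP => [//|/(_ v)]; rewrite vx.
Qed.

Variable e : R.
Hypothesis e0 : 0 < e.

Let mesh : nat := (Num.truncn e^-1).+1.

Let mesh_gt0 : (0 < mesh)%N. Proof. by []. Qed.

Let mesh_le : mesh%:R^-1 <= e.
Proof.
rewrite -[leRHS]invrK lef_pV2 ?posrE ?invr_gt0 ?ltr0n//.
exact/ltW/truncnS_gt.
Qed.

Let subdivC : contractible_carrier simplices (fun s t => rips e [set x in s] t)
  (fun s => @rips_contraction R T F mesh [set x in s]).
Proof.
apply: rips_carrier => //.
- exact: simplices_face.
- move=> s u _ /face_subseq/mem_subseq us; apply/fintype.subsetP => x.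
  by rewrite !inE => /us.
- by case=> // x s _ _; apply/finset.set0Pn; exists x; rewrite inE mem_head.
Qed.

Let ripsC : contractible_carrier (rips_complex e) (fun s t => rips e (hull s) t)
  (fun s => @rips_contraction R T F mesh (hull s)).
Proof.
apply: rips_carrier => //.
- by move=> s u sK /face_subseq/mem_subseq; exact: rips_complex_sub.
- by move=> s u _ /face_subseq/mem_subseq us; exact: hull_mono.
- case=> // x s [_ [sU _]] _; have [xa xU] := sU x (mem_head _ _).
  have /finset.set0Pn[v vx] := admissible_supp xa.
  by apply/finset.set0Pn; exists v; apply: (fintype.subsetP xU).
Qed.

(* The transpose of a subdivision operator. *)
Let S := carrier_map (fun s => @rips_contraction R T F mesh [set x in s]).

Let S_carried := carrier_map_carried subdivC.
Let S_cob := carrier_map_cob subdivC.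
Let SB := carrier_mapB subdivC.

(** Selecting a vertex in the support of each point and then subdividing stays within the hull of a
    tuple, hence is homotopic to the identity. So [c] is cohomologous to the pullback of [S c],
    which is a coboundary on [K]. *)
Lemma rips_acyclic k : acyclic F simplices k -> acyclic F (rips_complex e) k.
Proof.
move=> acyc c cc.
have [v0 _|T0] := pickP T; last first.
  exists c => -[//|x s] [_ [sU _]] _; have [xa _] := sU x (mem_head _ _).
  by have /finset.set0Pn[v] := admissible_supp xa; have := T0 v.
have [b bP] : coboundary simplices k (S c).
  apply: acyc => s sK sk; rewrite -S_cob// (S_carried (d := fun=> 0 - 0))//.
    by rewrite SB// subrr.
  by move=> t st tk; rewrite subrr cc ?tk//; exact: rips_in_complex st.
have sel_hull s : rips_complex e s -> [set x in map (select v0) s] \subset hull s.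
  move=> [_ [sU _]]; apply/fintype.subsetP => v; rewrite inE => /mapP[x xs ->].
  by have [xa /fintype.subsetP] := sU x xs; apply; exact: selectP.
have sel_K s : rips_complex e s -> simplices (map (select v0) s).
  by move=> sK; apply: complexK.2 (sel_hull _ sK); case: sK.
have [d dP] : coboundary (rips_complex e) k
    (fun s => c s - S c (map (select v0) s)).
  apply: (carried_nullhomotopic ripsC
    (A := fun c s => c s - S c (map (select v0) s))).
  - move=> d d' s sK dd'; have -> : d s = d' s by apply: dd' => //; case: sK.
    congr (_ - _); apply: S_carried; first exact: sel_K.
    move=> t [tU te]; rewrite size_map; apply: dd'; split=> // x /tU[xa xU].
    by split=> //; apply: fintype.subset_trans xU (sel_hull _ sK).
  - split=> [d d' s /sel_K sK|d s /sel_K sK].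
      by rewrite [in LHS]/S SB// -!/(S _ _); ring.
    by rewrite cobB cob_map [in LHS]/S S_cob.
  - by move=> d _; rewrite /S /carrier_map /= subrr.
  - move=> s t [sK _] st _ tk; apply: cc => //; exact: rips_in_complex sK st.
exists (fun s => d s + b (map (select v0) s)) => s sK sk.
rewrite cobD -dP// cob_map -bP ?size_map ?subrK//; exact: sel_K.
Qed.

(** Subdividing a simplex and then applying [f] yields sequences of its own vertices, so this
    composite is homotopic to the identity of [K]; transporting a primitive by [S] gives one for
    [c]. *)
Lemma rips_descent k (f : 'rV[R]_#|T| -> T) c :
  (forall s, rips_complex e s -> {subset map f s <= hull s}) ->
  cocycle simplices k c ->
  coboundary (rips_complex e) k (fun s => c (map f s)) ->
  coboundary simplices k (c : seq T -> F).
Proof.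
move=> fP cc [b bP].
have [d dP] : coboundary simplices k (fun s => c s - S (fun t => c (map f t)) s).
  apply: (carried_nullhomotopic (simplex_carrier F simplices_face)
    (A := fun c s => c s - S (fun t => c (map f t)) s)).
  - move=> d d' s sK dd'; have -> : d s = d' s by apply: dd'.
    congr (_ - _); apply: S_carried => // t st ts; apply: dd' => [x xt|].
      have [tU _] := st; have tK := rips_in_complex sK st.
      have : hull t \subset [set x in s] by apply: hull_subset => y /tU[].
      by move=> /fintype.subsetP/(_ _ (fP _ tK _ xt)); rewrite inE.
    by rewrite size_map.
  - split=> [d d' s sK|d s sK].
      by rewrite [in LHS]/S SB// -!/(S _ _); ring.
    rewrite cobB -S_cob//; congr (_ - _); apply: S_carried => // t _ _.
    by rewrite cob_map.
  - by move=> d _; rewrite /S /carrier_map /= subrr.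
  - move=> s t sK ts _ tk; apply: cc => //; exact: simplices_sub sK ts.
exists (fun s => d s + S b s) => s sK sk.
rewrite cobD -dP// -S_cob// (S_carried (d := fun t => c (map f t)))// ?subrK//.
move=> t st tk; rewrite bP// ?tk//; exact: rips_in_complex sK st.
Qed.

End RipsComplex.

(** * Factorization through a complex with trivial cohomology *)

Section Realizations.
Variables (R : realType) (T : finType).
Local Open Scope ring_scope.
Implicit Types (x y : 'rV[R]_#|T|) (K : {set {set T}}).

Lemma realizationP K x : geometric_realization K x <->
  [/\ forall v, 0 <= bcoord x v, \sum_v bcoord x v = 1 & supp x \in K].
Proof.
rewrite /geometric_realization /= sum_bcoord; split=> -[x0 x1 xK]; split=> // i.
  exact: x0.
by rewrite -(enum_valK i); apply: x0.
Qed.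

Lemma realization_admissible K x : geometric_realization K x -> admissible x.
Proof.
case/realizationP => x0 x1 _; split=> [v|]; last by rewrite x1; lra.
rewrite x0 -x1 (bigD1 v)//= lerDl; exact: sumr_ge0.
Qed.

Definition normalise x := bpoint (fun v => bcoord x v / \sum_u bcoord x u).

Lemma supp_normalise x : admissible x -> supp (normalise x) = supp x.
Proof.
move=> [_ xs]; apply/setP => v; rewrite !inE bcoord_point mulf_eq0 negb_or.
have s0 : 0 < \sum_u bcoord x u by lra.
by rewrite invr_eq0 [X in _ && X]lt0r_neq0// andbT.
Qed.

Lemma normalise_realization K x : admissible x -> supp x \in K ->
  geometric_realization K (normalise x).
Proof.
move=> xa xK; apply/realizationP; rewrite supp_normalise//.
case: xa => x01 xs; have s0 : 0 < \sum_u bcoord x u by lra.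
split=> // [v|]; first by rewrite bcoord_point divr_ge0 ?(ltW s0)//; case/andP: (x01 v).
under eq_bigr do rewrite bcoord_point.
by rewrite -mulr_suml divff// lt0r_neq0.
Qed.

Lemma normalise_id K x : geometric_realization K x -> normalise x = x.
Proof.
by case/realizationP => _ x1 _; apply: bcoordP => v; rewrite bcoord_point x1 divr1.
Qed.

(** Lipschitz constant of [normalise]: the 2 bounds the inverse of a coordinate sum, and [#|T|.+1]
    counts one coordinate plus the variation of the sum. The condition [C * e <= 1] also ensures
    that truncation at [e] leaves at least half of the mass. *)
Let C : R := 2 * (#|T|.+1)%:R.

Lemma close_normalise e x y : admissible x -> admissible y -> eclose e x y ->
  eclose (C * e) (normalise x) (normalise y).
Proof.
move=> [x01 xs] [y01 ys] xy v; rewrite !bcoord_point.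
move: xs ys (xy v); set S := \sum_u bcoord x u; set S' := \sum_u bcoord y u => xs ys xyv.
have SS : `|S' - S| <= #|T|%:R * e.
  rewrite distrC -sumrB; apply: le_trans (ler_norm_sum _ _ _) _.
  by rewrite mulr_natl -sumr_const; apply: ler_sum => u _.
have yS : bcoord y v <= S'.
  by rewrite /S' (bigD1 v)//= lerDl sumr_ge0// => u _; case/andP: (y01 u).
have -> : bcoord x v / S - bcoord y v / S' =
    S^-1 * (bcoord x v - bcoord y v) + S^-1 * ((bcoord y v / S') * (S' - S)).
  by field; apply/andP; split; apply: lt0r_neq0; lra.
have Si : 0 <= S^-1 <= 2.
  have S0 : 0 < S by lra.
  rewrite invr_ge0 ltW//= -[S^-1]mul1r ler_pdivrMr//; lra.
have yS1 : 0 <= bcoord y v / S' <= 1.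
  rewrite divr_ge0 ?ler_pdivrMr ?mul1r ?yS//; try lra.
  by case/andP: (y01 v).
rewrite -mulrDr normrM ger0_norm; last by case/andP: Si.
have : `|bcoord x v - bcoord y v + bcoord y v / S' * (S' - S)| <= e + #|T|%:R * e.
  apply: le_trans (ler_normD _ _) _; apply: lerD => //.
  rewrite normrM ger0_norm; last by case/andP: yS1.
  apply: le_trans _ SS; rewrite ler_piMl//; by case/andP: yS1.
have -> : C * e = 2 * (e + #|T|%:R * e) by rewrite /C -[#|T|.+1%:R]natr1; ring.
move=> h; apply: ler_pM => //; by case/andP: Si.
Qed.

(* Dropping the coordinates below [e] puts the supports of nearby points in a
   common simplex. *)
Definition truncate (e : R) x := bpoint (fun v => Num.max (bcoord x v - e) 0).

Lemma admissible_truncate K e x : geometric_realization K x ->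
  0 <= e -> C * e <= 1 -> admissible (truncate e x).
Proof.
move=> xK e0 e1; have [x01 _] := realization_admissible xK.
have /realizationP[_ x1 _] := xK.
split=> [v|].
  by rewrite bcoord_point le_max lexx orbT ge_max ler01 andbT; case/andP: (x01 v) => *; lra.
have : \sum_v (bcoord x v - e) <= \sum_v bcoord (truncate e x) v.
  by apply: ler_sum => v _; rewrite bcoord_point le_max lexx.
rewrite sumrB x1 sumr_const -mulr_natl => h; move: e1; rewrite /C -[#|T|.+1%:R]natr1.
by move: h; set S := \sum_v _; set n := #|T|%:R => *; lra.
Qed.

Lemma close_truncate d e x y : 0 <= d -> eclose d x y ->
  eclose d (truncate e x) (truncate e y).
Proof.
move=> d0 xy v; rewrite !bcoord_point; apply: max_lipschitz.
  by rewrite opprB addrA subrK.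
by rewrite subrr normr0.
Qed.

Lemma truncate_close K e x : geometric_realization K x -> 0 <= e ->
  eclose e (truncate e x) x.
Proof.
move=> /realizationP[x0 _ _] e0 v; rewrite bcoord_point ler_distl.
have xv := x0 v.
by case: (leP (bcoord x v - e) 0) => *; apply/andP; split; lra.
Qed.

Lemma supp_truncate e x y : eclose e x y -> supp (truncate e x) \subset supp y.
Proof.
move=> xy; apply/fintype.subsetP => v; apply: contraTT => vy.
rewrite inE negbK bcoord_point; apply/eqP/max_idPr.
by have := xy v; rewrite (supp0 vy) subr0 ler_norml => /andP[_]; lra.
Qed.

End Realizations.

Section Factorization.
Variables (F : fieldType) (R : realType) (T T' : finType).
Variables (L K : {set {set T}}) (M : {set {set T'}}).
Hypotheses (cL : simplicial_complex L) (cK : simplicial_complex K).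
Hypotheses (cM : simplicial_complex M) (LK : L \subset K).
Local Open Scope ring_scope.

Definition close_continuous (A : finType) (B : finType) (X : {set {set A}})
    (f : 'rV[R]_#|A| -> 'rV[R]_#|B|) :=
  forall e : R, 0 < e -> exists2 d : R, 0 < d & forall x y,
    geometric_realization X x -> geometric_realization X y ->
    eclose d x y -> eclose e (f x) (f y).

Variables (a : 'rV[R]_#|T| -> 'rV[R]_#|T'|) (b : 'rV[R]_#|T'| -> 'rV[R]_#|T|).
Hypotheses (aM : forall x, geometric_realization L x -> geometric_realization M (a x)).
Hypotheses (bK : forall x, geometric_realization M x -> geometric_realization K (b x)).
Hypothesis baK : forall x, geometric_realization L x -> b (a x) = x.
Hypotheses (ca : close_continuous L a) (cb : close_continuous M b).

Let C (A : finType) : R := 2 * (#|A|.+1)%:R.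
Let C0 A : 0 < C A. Proof. by rewrite /C mulr_gt0 ?ltr0n. Qed.

Lemma le_close d e (A : finType) (x y : 'rV[R]_#|A|) : d <= e -> eclose d x y -> eclose e x y.
Proof. by move=> de xy v; apply: le_trans (xy v) de. Qed.

(** Scales are fixed backwards: [eK] for truncation in [K], then [eM] by continuity of [b], then
    [eL] by continuity of [a]. The cocycle is pulled back to close tuples of [M], where it bounds,
    then to those of [L], and finally descends to [L]. *)
Lemma coboundary_factor k (c : seq T -> F) : acyclic F (simplices M) k ->
  cocycle (simplices K) k c -> coboundary (simplices L) k c.
Proof.
move=> acyc cc.
have [v0 _|T0] := pickP T; last first.
  by exists c => -[//|x s]; have := T0 x.
pose eK := (C T)^-1; have eK0 : 0 < eK by rewrite invr_gt0.
have CeK : C T * eK <= 1 by rewrite divff// lt0r_neq0.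
have [db db0 dbP] := cb eK0.
(* The first bound keeps truncations admissible in [M]; the second makes points at distance [eM] lie
   within [db] after normalisation. *)
pose eM := Num.min (C T')^-1 (db / C T').
have eM0 : 0 < eM by rewrite lt_min invr_gt0 C0 divr_gt0.
have CeM : C T' * eM <= 1.
  rewrite -ler_pdivlMl// mulr1 ge_min lexx//.
have Cdb : C T' * eM <= db.
  by rewrite -ler_pdivlMl// ge_min [_^-1 * _]mulrC lexx orbT.
have [da da0 daP] := ca eM0.
pose eL := da / C T; have eL0 : 0 < eL by rewrite divr_gt0.
have Cda : C T * eL = da by rewrite /eL mulrCA divff ?mulr1// lt0r_neq0.
pose A x := truncate eM (a (normalise x)).
pose B x := truncate eK (b (normalise x)).
have normL s x : rips_complex L eL s -> x \in s ->
    admissible x /\ geometric_realization L (normalise x).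
  move=> [sL [sU _]] xs; have [xa xU] := sU x xs; split=> //.
  by apply: normalise_realization => //; apply: cL.2 sL xU.
have normM s x : rips_complex M eM s -> x \in s ->
    admissible x /\ geometric_realization M (normalise x).
  move=> [sL [sU _]] xs; have [xa xU] := sU x xs; split=> //.
  by apply: normalise_realization => //; apply: cM.2 sL xU.
have admA x : geometric_realization L (normalise x) -> admissible (A x).
  by move=> xL; apply: admissible_truncate (aM xL) (ltW eM0) CeM.
have admB x : geometric_realization M (normalise x) -> admissible (B x).
  by move=> xL; apply: admissible_truncate (bK xL) (ltW eK0) CeK.
have HA s : rips_complex L eL s -> rips_complex M eM (map A s).
  case: s => [_|x0 s sL].
    by split; rewrite ?/hull ?big_nil ?cM.1//; exact: rips_nil.
  have closea x y : x \in x0 :: s -> y \in x0 :: s ->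
      eclose eM (a (normalise x)) (a (normalise y)).
    move=> xs ys; have [xa xL] := normL _ _ sL xs; have [ya yL] := normL _ _ sL ys.
    apply: daP => //; rewrite -Cda; apply: close_normalise => //.
    by case: sL => _ [_ se]; exact: se.
  (* After truncation every image is supported in the support of the image of [x0], which serves as
     the common simplex. *)
  have [_ /aM/realizationP[_ _ x0M]] := normL _ _ sL (mem_head _ _).
  apply: (rips_in_complex cM x0M).
  split=> [x /mapP[y ys ->]|x y /mapP[x' xs ->] /mapP[y' ys ->]].
    have [_ yL] := normL _ _ sL ys.
    by split; [exact: admA|apply/supp_truncate/closea; rewrite ?mem_head].
  by apply: close_truncate (ltW eM0) _; exact: closea.
have HB s : rips_complex M eM s -> simplices K (map (select v0 \o B) s).
  case: s => [_|x0 s sM].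
    by rewrite /simplices (_ : [set _ in _] = finset.set0) ?cK.1//; apply/setP => x; rewrite !inE.
  have closeb x y : x \in x0 :: s -> y \in x0 :: s ->
      eclose eK (b (normalise x)) (b (normalise y)).
    move=> xs ys; have [xa xL] := normM _ _ sM xs; have [ya yL] := normM _ _ sM ys.
    apply: dbP => //; apply: le_close Cdb _; apply: close_normalise => //.
    by case: sM => _ [_ se]; exact: se.
  have [_ /bK/realizationP[_ _ x0K]] := normM _ _ sM (mem_head _ _).
  apply: cK.2 x0K _; apply/fintype.subsetP => v; rewrite inE => /mapP[x xs ->].
  have [_ xM] := normM _ _ sM xs.
  have := selectP v0 (admB _ xM).
  by apply/fintype.subsetP/supp_truncate/closeb; rewrite ?mem_head.
have [d dP] : coboundary (rips_complex M eM) k (fun s => c (map (select v0 \o B) s)).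
  apply: (rips_acyclic cM eM0 acyc) => s sM sk.
  by rewrite cob_map cc ?size_map//; exact: HB.
apply: (rips_descent cL eL0 (f := select v0 \o B \o A)).
- move=> s sL v /mapP[x xs ->].
  have [xa xL] := normL _ _ sL xs.
  have AxM : geometric_realization M (normalise (A x)).
    apply: normalise_realization; first exact: admA.
    have /realizationP[_ _ xM] := aM xL.
    apply: cM.2 xM _; apply: supp_truncate => u.
    by rewrite subrr normr0 ltW.
  have := selectP v0 (admB _ AxM).
  apply/fintype.subsetP; apply: fintype.subset_trans (supp_hull xs).
  (* Truncating and renormalising moves [a (normalise x)] so little that its image under [b] is
     [eK]-close to [b (a (normalise x))], that is, to [normalise x]. *)
  rewrite -(supp_normalise xa); apply: supp_truncate.
  rewrite -[X in eclose _ _ X](baK xL); apply: dbP => //; first exact: aM.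
  rewrite -[X in eclose _ _ X](normalise_id (aM xL)).
  apply: le_close Cdb _; apply: close_normalise; first exact: admA.
    exact: realization_admissible (aM xL).
  exact: truncate_close (aM xL) (ltW eM0).
- by move=> s sL sk; apply: cc => //; apply: (fintype.subsetP LK).
exists (fun s => d (map A s)) => s sL sk.
by rewrite cob_map -dP ?size_map//; [rewrite -map_comp|exact: HA].
Qed.

End Factorization.

(** * The double complex of a colouring *)

Section Coloring.
Variables (F : fieldType) (T : finType) (n : nat) (K : {set {set T}}).
Variable V : 'I_n.+1 -> {set T}.
Local Open Scope ring_scope.
Implicit Types (s u : seq T) (I J : seq 'I_n.+1).

(** The intersection of the members of the cover that are indexed by [I]; its simplices use only the
    complementary colours. For [I] empty it is [K] itself, the augmentation of the rows. *)
Definition avoiding I s := simplices K s /\ forall i v, i \in I -> v \in s -> v \notin V i.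

Hypothesis complexK : simplicial_complex K.
Hypothesis missing_color : forall s, simplices K s -> exists i, forall v, v \in s -> v \notin V i.
Hypothesis V_cover : forall v, [set v] \in K -> exists i, v \in V i.

Let incr := increasing (@nat_of_ord n.+1).

Lemma avoiding_sub I J s u : avoiding I s -> {subset J <= I} -> {subset u <= s} ->
  avoiding J u.
Proof.
move=> [sK Is] JI us; split; first exact: simplices_sub sK us.
by move=> i v /JI iI /us; exact: Is.
Qed.

Let missing s := [seq i <- enum 'I_n.+1 | [forall v, (v \in s) ==> (v \notin V i)]].

Let mem_missing s i : reflect (forall v, v \in s -> v \notin V i) (i \in missing s).
Proof.
rewrite mem_filter mem_enum andbT.
by apply: (iffP forallP) => si v; [have /implyP := si v|apply/implyP; exact: si].
Qed.

Let hc s := increasing_contraction (F := F) (@nat_of_ord n.+1) (missing s).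

(** The colours missed by [s] span a full simplex, nonempty by [missing_color], and the row of [s]
    is its augmented cochain complex. *)
Lemma color_exact s p (y : seq 'I_n.+1 -> F) : simplices K s ->
  (forall I, incr I -> avoiding I s -> size I = p.+1 -> cob y I = 0) ->
  forall I, incr I -> avoiding I s -> size I = p -> y I = cob (hc s y) I.
Proof.
move=> sK y0 I iI [_ Is] Ip.
have H : contractible_carrier (F := F) (fun=> True)
  (fun s t : seq 'I_n.+1 => incr t /\ {subset t <= s})
  (increasing_contraction (@nat_of_ord n.+1)).
  exact: increasing_carrier (@ord_inj n.+1) _ _.
have mN : missing s != [::].
  have [i /mem_missing] := missing_color sK; by case: (missing s).
have Im : {subset I <= missing s} by move=> i /Is iI'; apply/mem_missing.
rewrite -[LHS](contractionP H y (s := missing s) (t := I))// -[RHS]addr0; congr (_ + _).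
rewrite (contraction_local H (d := fun=> 0 - 0))//.
  by rewrite (contractionB H) subrr.
move=> J [iJ Jm] Jp; rewrite subrr y0 ?Jp ?Ip//; split=> // i v /Jm/mem_missing; exact.
Qed.

(* Cochains [b I s] of bidegree [(size I, size s)], where the simplex [s] avoids
   the colours [I].  The rows ([s] fixed) are exact, since [s] misses a colour;
   the zigzag lemma uses the vanishing of the cohomology of the columns. *)
Definition bicocycle p q (b : seq 'I_n.+1 -> seq T -> F) :=
  forall I s, incr I -> avoiding I s -> size I = p.+1 -> size s = q.+1 ->
  cob (fun J => cob (b J) s) I = 0.

Definition bicoboundary p q (b : seq 'I_n.+1 -> seq T -> F) :=
  exists e e' : seq 'I_n.+1 -> seq T -> F,
  forall I s, incr I -> avoiding I s -> size I = p -> size s = q ->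
  b I s = cob (e I) s + cob (e'^~ s) I.

(** The columns turn the colour differential of [b] into the simplex differential of some [b'],
    which is a bicocycle one step further. If [b'] is a bicoboundary of [e] and [e'], then [b] minus
    the simplex differential of [e'] is closed along the rows, hence exact. *)
Lemma zigzag_step p q b :
  (forall b', bicocycle p.+1 q b' -> bicoboundary p.+1 q b') ->
  (forall I, incr I -> size I = p.+1 ->
    coboundary (avoiding I) q (fun s => cob (b^~ s) I)) ->
  bicoboundary p q.+1 b.
Proof.
move=> IH col.
have /choice[b' b'P] : forall I, exists b', incr I -> size I = p.+1 ->
    forall s, avoiding I s -> size s = q.+1 -> cob (b^~ s) I = cob b' s.
  move=> I; have [iI|] := boolP (incr I); last by exists (fun=> 0).
  have [Ip|Ip] := eqVneq (size I) p.+1; last by exists (fun=> 0) => _ /eqP; rewrite (negPf Ip).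
  by have [d dP] := col I iI Ip; exists d.
have [|e [e' ee']] := IH b'.
  move=> I s iI Is Ip sq; rewrite -[RHS](cob_cob (b^~ s) I).
  apply: eq_cob => J JI; rewrite b'P//.
  - exact: increasing_face iI JI.
  - by move: Ip; rewrite (face_size JI) => -[].
  - by apply: avoiding_sub Is _ _ => //; exact/mem_subseq/face_subseq.
exists e', (fun J s => hc s (fun J' => b J' s - cob (e' J') s) J) => I s iI Is Ip sq.
rewrite -(color_exact (p := p) (y := fun J' => b J' s - cob (e' J') s))//.
- by rewrite addrC subrK.
- by case: Is.
move=> J iJ Js Jp; rewrite cobB b'P// cobC -cobB.
rewrite -[RHS](cob_cob (e J) s); apply: eq_cob => u us.
rewrite ee' ?addrK//.
  by apply: avoiding_sub Js _ _ => //; exact/mem_subseq/face_subseq.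
by move: sq; rewrite (face_size us) => -[].
Qed.

Hypothesis columns : forall I k, incr I -> (2 <= size I)%N -> (1 <= k)%N ->
  (size I + k = n.+1)%N -> acyclic F (avoiding I) k.

Lemma zigzag p q b : (1 <= p)%N -> (p + q = n.+1)%N ->
  bicocycle p q b -> bicoboundary p q b.
Proof.
elim: q p b => [|q IH] p b p1 pq bP.
  (* Here [p = n + 1], and there is no increasing sequence of [n + 2] colours: closedness along the
     row is vacuous. *)
  exists (fun _ _ => 0), (fun J s => hc s (b^~ s) J) => I s iI Is Ip s0.
  rewrite cob0 add0r; apply: (color_exact (p := p)) => //; first by case: Is.
  move=> J iJ _ Jp; exfalso.
  have := uniq_leq_size (increasing_uniq iJ)
    (fun i _ => mem_enum predT i).
  by rewrite Jp size_enum_ord; move: pq; lia.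
apply: zigzag_step => [b' b'P|I iI Ip].
  by apply: IH => //; rewrite addSn -addnS.
case: q {IH} pq bP => [|q] pq bP.
  (* Here [I] contains all the colours, so only the empty simplex avoids it. *)
  exists (fun=> 0) => -[//|x s] [sK Is] _; exfalso.
  have [i xi] : exists i, x \in V i.
    by apply: V_cover; apply: complexK.2 sK _; rewrite finset.sub1set inE mem_head.
  have iI' : i \in I.
    have := uniq_min_size (increasing_uniq iI)
      (fun i _ => mem_enum predT i).
    by rewrite size_enum_ord Ip => -[|_ ->]; [move: pq; lia|rewrite mem_enum].
  by have := Is i x iI' (mem_head _ _); rewrite xi.
apply: columns => //; [by rewrite Ip|by rewrite Ip; move: pq; lia|].
by move=> s Is sq; rewrite -(bP I s)// cobC.
Qed.

(** The zigzag starts from [c] placed at the empty set of colours; its first column, a single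
    deleted colour, is left to the hypothesis [vert]. The colour differential vanishes at [[::]], so
    a bicoboundary there is an ordinary coboundary. *)
Lemma acyclic_of_columns :
  (forall i (c : seq T -> F), cocycle (simplices K) n c -> coboundary (avoiding [:: i]) n c) ->
  acyclic F (simplices K) n.
Proof.
move=> vert c cc.
have [||e [e' ee']] := @zigzag_step 0 n (fun _ s => c s).
- by move=> b'; apply: zigzag.
- move=> [//|i [|]//] _ _; have [b bP] := vert i c cc.
  by exists b => s si sn /=; rewrite subr0 bP.
exists (e [::]) => s sK sn; rewrite (ee' [::])//= ?addr0//.
Qed.

End Coloring.

(** * From homology to cohomology *)

Section Duality.
Variables (F : fieldType) (T : finType).
Local Open Scope ring_scope.
Local Notation chain := {ffun {set T} -> F^o}.
Implicit Types (K : {set {set T}}) (k : nat) (z : chain) (g : {set T} -> F).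

Let rank (v : T) : nat := enum_rank v.

Lemma enum_rank_nat_inj : injective rank.
Proof. by move=> u v /ord_inj/enum_rank_inj. Qed.

Lemma reduced_homology_eq0 K k : (forall h : reduced_homology F K k, h = 0) ->
  forall z, z \in cycles F K k -> z \in boundaries F K k.
Proof.
move=> h0 z zc; pose x := vsproj (cycles F K k) z.
have : x \in cycle_boundaries F K k.
  by rewrite -[x]subr0 Quotient.idealrBE; apply/eqP/(etrans (h0 _))/esym/h0.
by rewrite /cycle_boundaries -memv_preim lfunE /= vsprojK.
Qed.

Lemma boundaryE z : boundary F T z =
  \sum_(s : {set T}) \sum_(v in s) (z s * face_sign F s v) *: simplex F (s :\ v).
Proof. by rewrite lfunE. Qed.

Lemma boundary_simplex (s : {set T}) : boundary F T (simplex F s) =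
  \sum_(v in s) face_sign F s v *: simplex F (s :\ v).
Proof.
rewrite boundaryE (bigD1 s)//= [X in _ + X]big1 ?addr0 => [|t /negPf ts].
  by apply: eq_bigr => v _; rewrite ffunE eqxx mul1r.
by rewrite big1// => v _; rewrite ffunE ts mul0r scale0r.
Qed.

Definition pairing g z : F := \sum_s z s * g s.

Lemma pairingD g y z : pairing g (y + z) = pairing g y + pairing g z.
Proof. by rewrite -big_split; apply: eq_bigr => s _; rewrite !ffunE mulrDl. Qed.

Lemma pairingZ g a z : pairing g (a *: z) = a * pairing g z.
Proof. by rewrite mulr_sumr; apply: eq_bigr => s _; rewrite ffunE mulrA. Qed.

Lemma pairing0 g : pairing g 0 = 0.
Proof. by rewrite /pairing big1// => s _; rewrite ffunE mul0r. Qed.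

Lemma pairing_sum g I (r : seq I) (P : pred I) (z : I -> chain) :
  pairing g (\sum_(i <- r | P i) z i) = \sum_(i <- r | P i) pairing g (z i).
Proof. exact: (big_morph _ (pairingD g) (pairing0 g)). Qed.

Lemma pairing_simplex g s : pairing g (simplex F s) = g s.
Proof.
rewrite /pairing (bigD1 s)//= big1 ?addr0 => [|t /negPf ts]; rewrite ffunE.
  by rewrite eqxx mul1r.
by rewrite ts mul0r.
Qed.

(** In an increasing sequence the position of an entry, which gives its sign in [cob], is the number
    of smaller entries counted by [face_sign]. *)
Lemma cob_increasing g s : increasing rank s ->
  cob (fun u => g [set x in u]) s =
  \sum_(v in [set x in s]) face_sign F [set x in s] v * g ([set x in s] :\ v).
Proof.
elim: s g => [|x t IH] g xt /=.
  by rewrite big_pred0// => v; rewrite !inE.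
have xlt : {in t, forall v, rank x < rank v}%N.
  exact/allP/(order_path_min (fun _ _ _ => @ltn_trans _ _ _) xt).
have xNt : x \notin t by apply/negP => /xlt; rewrite ltnn.
have xE : [set y in x :: t] = x |: [set y in t] by apply/setP => y; rewrite !inE.
rewrite xE big_setU1 ?inE//=; congr (_ + _).
  rewrite /face_sign (_ : [set w in _ | _] = finset.set0) ?cards0 ?expr0 ?mul1r.
    by congr g; apply/setP => y; rewrite !inE; case: eqVneq => // ->; rewrite (negPf xNt).
  apply/setP => w; rewrite !inE; apply/negP => /andP[/predU1P[->|/xlt]].
    by rewrite ltnn.
  by rewrite /rank => /ltnW; rewrite leqNgt => /negPf->.
have -> : cob (fun u => g [set y in x :: u]) t = cob (fun u => g (x |: [set y in u])) t.
  by apply: eq_cob => u _; congr g; apply/setP => y; rewrite !inE.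
rewrite (IH (fun u => g (x |: u))) ?(path_sorted xt)//; last exact: path_sorted xt.
rewrite -[LHS]mulN1r mulr_sumr; apply: eq_bigr => v; rewrite inE => vt.
rewrite mulrA mulN1r; congr (_ * g _); last first.
  apply/setP => y; rewrite !inE; have [->|//] := eqVneq y x.
  by rewrite orTb andbT; apply/esym; apply: contraNneq xNt => ->.
rewrite /face_sign (_ : [set w in x |: _ | _] =
    x |: [set w in [set y in t] | (enum_rank w < enum_rank v)%N]).
  by rewrite cardsU1 !inE (negPf xNt) exprS mulN1r.
apply/setP => w; rewrite !inE; case: eqVneq => // ->; rewrite andTb.
exact: xlt.
Qed.

Lemma chains_boundary_pairing K k g :
  (forall s, s \in K -> #|s| = k.+1 -> pairing g (boundary F T (simplex F s)) = 0) ->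
  forall z, z \in chains F K k -> pairing g (boundary F T z) = 0.
Proof.
move=> g0 z /memv_sumP[y yP ->].
rewrite linear_sum pairing_sum big1// => s /andP[sK /eqP sk].
have /vlineP[a ->] : y s \in <[simplex F s]>%VS by apply: yP; rewrite sK sk eqxx.
by rewrite linearZ pairingZ g0// mulr0.
Qed.

(** A cocycle is a functional that kills boundaries, hence cycles when homology vanishes; over a
    field it therefore extends from the image of the boundary map to all chains. *)
Lemma acyclic_of_homology K k : simplicial_complex K ->
  (forall h : reduced_homology F K k, h = 0) -> acyclic F (simplices K) k.
Proof.
move=> cK /reduced_homology_eq0 h0.
apply/(acyclic_increasing F k enum_rank_nat_inj (simplices_sub cK)).
move=> c cc.
pose g (s : {set T}) := c (rank_sort rank (enum s)).
have gE u : increasing rank u -> g [set x in u] = c u.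
  move=> iu; congr c; apply: (@irr_sorted_eq _ (fun x y => rank x < rank y)%N).
  - by move=> y x z; exact: ltn_trans.
  - by move=> x; exact: ltnn.
  - exact (increasing_rank_sort enum_rank_nat_inj (enum_uniq _)).
  - exact iu.
  - by move=> x; rewrite mem_sort mem_enum inE.
have increasing_set (s : {set T}) : increasing rank (rank_sort rank (enum s)) /\
    [set x in rank_sort rank (enum s)] = s.
  split; first exact (increasing_rank_sort enum_rank_nat_inj (enum_uniq _)).
  by apply/setP => x; rewrite inE mem_sort mem_enum.
have pairing_boundary h s : increasing rank s ->
    pairing h (boundary F T (simplex F [set x in s])) = cob (fun u => h [set x in u]) s.
  move=> si; rewrite cob_increasing// boundary_simplex pairing_sum.
  by apply: eq_bigr => v _; rewrite pairingZ pairing_simplex.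
have size_set s : increasing rank s -> #|[set x in s]| = size s.
  by move=> /increasing_uniq us; rewrite cardsE; exact/card_uniqP.
have bound0 z : z \in boundaries F K k -> pairing g z = 0.
  move=> /memv_imgP[y yK ->]; apply: chains_boundary_pairing yK => s sK sk.
  have [si sE] := increasing_set s; rewrite -sE pairing_boundary//.
  rewrite (eq_cob (d := c)); last first.
    by move=> u us; rewrite gE//; exact: increasing_face us.
  by apply: cc; rewrite -?size_set// ?sE//; split=> //; rewrite /simplices sE.
(* The functional [g] vanishes on cycles, so it factors through the boundary. *)
pose f : 'End(chain) := (boundary F T \o projv (chains F K k))%VF.
pose h (s : {set T}) := pairing g (projv (chains F K k) ((f^-1)%VF (simplex F s))).
exists (fun u => h [set x in u]) => s [sK si] sk; rewrite -gE// -pairing_boundary//.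
set z := simplex F _.
have zK : z \in chains F K k.
  rewrite (subvP (sumv_sup [set x in s] _ (subvv _)))// ?memv_line//.
  by rewrite sK size_set// sk eqxx.
(* Projecting the chosen preimage makes [w] a chain of [K] with the same boundary as [z], so [w - z]
   is a cycle and [g] takes the same value on both. *)
pose w := projv (chains F K k) ((f^-1)%VF (boundary F T z)).
have fz : f z = boundary F T z by rewrite comp_lfunE projv_id.
have fw : boundary F T w = boundary F T z.
  by rewrite -[LHS]comp_lfunE -/f -fz limg_lfunVK// memv_img// memvf.
have : pairing g (w - z) = 0.
  apply/bound0/h0; rewrite memv_cap memv_ker linearB /= fw subrr eqxx andbT.
  by rewrite rpredB// memv_proj.
rewrite pairingD -scaleN1r pairingZ mulN1r => /eqP; rewrite subr_eq0 => /eqP.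
rewrite {1}/z pairing_simplex => <-; rewrite /w boundary_simplex !linear_sum /=.
rewrite !pairing_sum; apply: eq_bigr => v _.
by rewrite !linearZ /= !pairingZ pairing_simplex.
Qed.

End Duality.

(** * Uniform continuity on realizations *)

Section Continuity.
Variable R : realType.
Local Open Scope classical_set_scope.
Local Open Scope ring_scope.

Lemma cvg_row (X : Type) (F : set_system X) (FF : Filter F) n
    (f : X -> 'rV[R]_n) (y : 'rV[R]_n) :
  (forall i, (fun x => f x ord0 i) @ F --> y ord0 i) -> f @ F --> y.
Proof.
move=> fy U [P yP PU]; rewrite /nbhs /=.
suff : F (fun x => forall i, P ord0 i (f x ord0 i)).
  apply: filterS => x xP; apply: PU => i j; rewrite ord1; exact: xP.
by apply: filter_forall => i; apply: fy; exact: yP.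
Qed.

Lemma within_comp (X Y Z : topologicalType) (A : set X) (B : set Y)
    (f : X -> Y) (g : Y -> Z) : (forall x, A x -> B (f x)) ->
  {within A, continuous f} -> {within B, continuous g} ->
  {within A, continuous (fun x => g (f x))}.
Proof.
move=> AB /subspace_continuousP cf /subspace_continuousP cg.
apply/subspace_continuousP => x Ax U /(cg _ (AB _ Ax)).
rewrite /= /nbhs /= => /(cf _ Ax); rewrite /nbhs /= /within /=.
by apply: filterS => z zU Az; apply: zU (Az) _; exact: AB.
Qed.

Lemma within_row (X : topologicalType) (A : set X) n (f : X -> 'rV[R]_n) :
  (forall i, {within A, continuous (fun x => f x ord0 i)}) ->
  {within A, continuous f}.
Proof.
move=> cf; apply/subspace_continuousP => x Ax; apply: cvg_row => i.
by have /subspace_continuousP := cf i; apply.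
Qed.

Lemma continuous_bcoord (T : finType) v : continuous (fun x : 'rV[R]_#|T| => bcoord x v).
Proof. exact: coord_continuous. Qed.

Lemma continuous_sum (X : topologicalType) (I : Type) (r : seq I) (f : I -> X -> R) :
  (forall i, continuous (f i)) -> continuous (fun x => \sum_(i <- r) f i x).
Proof.
by move=> cf; apply: continuous_big => [|i _]; [exact: add_continuous|exact: cf].
Qed.

Lemma realization_compact (T : finType) (K : {set {set T}}) :
  simplicial_complex K -> compact (geometric_realization (R := R) K).
Proof.
move=> cK.
have cube := @rV_compact R #|T| (fun=> `[0, 1]%classic)
  (fun _ => @segment_compact R 0 1).
apply: (subclosed_compact _ cube) => [|x xK i] /=; last first.
  have [+ _] := realization_admissible xK => /(_ (enum_val i)).
  by rewrite in_itv /= /bcoord enum_valK.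
have -> : geometric_realization K =
    (fun x : 'rV[R]_#|T| => \sum_v bcoord x v) @^-1` [set y : R | y = 1] `&`
    (\bigcap_(v in [set: T]) (@bcoord R T)^~ v @^-1` [set y | 0 <= y]) `&`
    [set x | supp x \in K].
  apply/seteqP; split=> x.
    by move=> /realizationP[x0 x1 xK]; split=> //; split=> // v _; exact: x0.
  by case=> -[x1 x0] xK; apply/realizationP; split=> // v; exact: x0.
apply: closedI; first apply: closedI.
- have /continuous_closedP : continuous (fun x : 'rV[R]_#|T| => \sum_v bcoord x v).
    by apply: continuous_sum => v; exact: continuous_bcoord.
  by apply; exact: closed_eq.
- apply: closed_bigI => v _.
  by have /continuous_closedP := @continuous_bcoord T v; apply; exact: closed_ge.
(* The complement is open: supports can only grow near a point, and [K] is closed under subsets. *)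
rewrite -openC openE => x /= xK; rewrite /interior.
suff : nbhs x (fun y => forall v, v \in supp x -> v \in supp y).
  apply: filterS => y xy yK; apply: xK.
  by apply: cK.2 yK _; apply/fintype.subsetP.
apply: (filter_forall (F := nbhs x)) => v; have [vx|_] := boolP (v \in supp x); last exact: nearW.
have : nbhs x (fun y => bcoord y v != 0).
  apply: (@continuous_bcoord T v x [set y | y != 0]).
  by apply: open_nbhs_nbhs; split; [exact: open_neq|move: vx; rewrite inE].
by apply: filterS => y yv _; rewrite inE.
Qed.

(** The Heine-Cantor theorem on the compact realization. *)
Lemma close_continuous_within (A B : finType) (K : {set {set A}})
    (f : 'rV[R]_#|A| -> 'rV[R]_#|B|) : simplicial_complex K ->
  {within geometric_realization K, continuous f} -> close_continuous K f.
Proof.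
move=> cK /subspace_continuousP cf e e0.
have /compact_near_coveringP cpt := realization_compact cK.
have near_close (C : finType) (x : 'rV[R]_#|C|) d : 0 < d -> nbhs x (fun y => eclose d x y).
  move=> d0; apply: (filter_forall (F := nbhs x)) => v.
  have /cvgrPdist_le := @continuous_bcoord C v x; exact.
pose P d x := geometric_realization K x -> forall y,
  geometric_realization K y -> eclose d x y -> eclose e (f x) (f y).
have {cpt} : \forall d \near 0^'+, geometric_realization K `<=` P d.
  apply: cpt => x xK; rewrite /P.
  have e2 : 0 < e / 2 by rewrite divr_gt0.
  have : nbhs x (fun y => geometric_realization K y -> eclose (e / 2) (f x) (f y)).
    exact: cf x xK _ (near_close _ (f x) _ e2).
  move=> /nbhs_ballP[r r0 rP].
  have r2 : 0 < r / 2 by rewrite divr_gt0.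
  have ball_close (y : 'rV[R]_#|A|) : (forall v, `|bcoord x v - bcoord y v| < r) -> ball x r y.
    move=> xy; split=> // i j; rewrite ord1 -[j]enum_valK; exact: xy.
  have r4 : 0 < r / 4 by rewrite divr_gt0.
  near=> y d => yK z zK yz v; rewrite /= in yK yz *.
  have xy : eclose (r / 4) x y by near: y; exact: near_close.
  have dr : d < r / 2 by near: d; exact: nbhs_right_lt.
  have /(rP y)/(_ yK v) fxy : ball x r y.
    by apply: ball_close => u; apply: le_lt_trans (xy u) _; lra.
  have /(rP z)/(_ zK v) fxz : ball x r z.
    apply: ball_close => u; rewrite -[X in `|X|](subrKA (bcoord y u)).
    apply: le_lt_trans (ler_normD _ _) _.
    have := xy u; have := yz u; lra.
  rewrite -[X in `|X|](subrKA (bcoord (f x) v)); apply: le_trans (ler_normD _ _) _.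
  rewrite distrC; lra.
move=> dP; have [d [d0 {}dP]] := filter_ex (filterI (nbhs_right_gt (0 : R)) dP).
by exists d => // x y xK; exact: (dP x).
Unshelve. all: by end_near. Qed.

End Continuity.

(** * Triangulated spheres *)

Section SphereMaps.
Variables (R : realType) (n : nat).
Local Open Scope classical_set_scope.
Local Open Scope ring_scope.
Let T0 : finType := 'I_n.+2.
Implicit Types (y z w : 'rV[R]_n.+1).

Definition boundary_simplex_complex : {set {set T0}} := [set s | s != [set: T0]]%SET.

Lemma boundary_simplex_complexP : simplicial_complex boundary_simplex_complex.
Proof.
split=> [|s t].
  by rewrite inE eq_sym; apply/set0Pn; exists ord0; rewrite inE.
rewrite !inE -!properT => sT ts; exact: sub_proper_trans ts sT.
Qed.

Definition dot y z : R := \sum_i y ord0 i * z ord0 i.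

Lemma dotC y z : dot y z = dot z y.
Proof. by apply: eq_bigr => i _; rewrite mulrC. Qed.

Lemma dotDl y z w : dot (y + z) w = dot y w + dot z w.
Proof. by rewrite -big_split; apply: eq_bigr => i _; rewrite !mxE mulrDl. Qed.

Lemma dotZl a y w : dot (a *: y) w = a * dot y w.
Proof. by rewrite mulr_sumr; apply: eq_bigr => i _; rewrite !mxE mulrA. Qed.

Lemma dotBl y z w : dot (y - z) w = dot y w - dot z w.
Proof. by rewrite dotDl -scaleN1r dotZl mulN1r. Qed.

Lemma dot_comb a b y z : dot (a *: y + b *: z) (a *: y + b *: z) =
  a ^+ 2 * dot y y + 2 * a * b * dot y z + b ^+ 2 * dot z z.
Proof.
rewrite dotDl !dotZl [dot y (_ + _)]dotC [dot z (_ + _)]dotC !dotDl !dotZl.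
by rewrite [dot z y]dotC; ring.
Qed.

Lemma dot_ge0 y : 0 <= dot y y.
Proof. by apply: sumr_ge0 => i _; rewrite -expr2 sqr_ge0. Qed.

Lemma dot_eq0 y : dot y y = 0 -> y = 0.
Proof.
move=> /eqP; rewrite psumr_eq0 => [/allP y0|i _]; last by rewrite -expr2 sqr_ge0.
apply/rowP => i; have := y0 i; rewrite mem_index_enum => /(_ isT).
by rewrite -expr2 expf_eq0 mxE => /eqP.
Qed.

Lemma sphereE y : @unit_sphere R n y <-> dot y y = 1.
Proof. by rewrite /unit_sphere /= /dot; under eq_bigr do rewrite expr2. Qed.

Lemma continuous_coord (i : 'I_n.+1) : continuous (fun y => y ord0 i).
Proof. exact: coord_continuous. Qed.

Lemma continuous_mul (X : topologicalType) (f g : X -> R) : continuous f ->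
  continuous g -> continuous (fun x => f x * g x).
Proof. by move=> cf cg x; apply: cvgM; [exact: cf|exact: cg]. Qed.

Lemma continuous_add (X : topologicalType) (f g : X -> R) : continuous f ->
  continuous g -> continuous (fun x => f x + g x).
Proof. by move=> cf cg x; apply: cvgD; [exact: cf|exact: cg]. Qed.

Lemma continuous_opp (X : topologicalType) (f : X -> R) : continuous f ->
  continuous (fun x => - f x).
Proof. by move=> cf x; apply: cvgN; exact: cf. Qed.

Lemma continuous_cst (X : topologicalType) (a : R) : continuous (fun _ : X => a).
Proof. by move=> x; exact: cvg_cst. Qed.

Lemma within_div (X : topologicalType) (A : set X) (f g : X -> R) : continuous f ->
  continuous g -> (forall x, A x -> g x != 0) ->
  {within A, continuous (fun x => f x / g x)}.
Proof.
move=> cf cg g0; apply/subspace_continuousP => x Ax; apply: cvgM.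
  exact: cvg_within_filter (cf x).
by apply: cvgV; [exact: g0|exact: cvg_within_filter (cg x)].
Qed.

Lemma continuous_dot (X : topologicalType) (f g : X -> 'rV[R]_n.+1) :
  (forall i, continuous (fun x => f x ord0 i)) ->
  (forall i, continuous (fun x => g x ord0 i)) ->
  continuous (fun x => dot (f x) (g x)).
Proof. by move=> cf cg; apply: continuous_sum => i; exact: continuous_mul. Qed.

Let N : R := n.+2%:R.
Let N0 : 0 < N. Proof. by rewrite ltr0n. Qed.

(* The point of the hyperplane of zero sum in R^(n+2) with first coordinates [y]. *)
Definition ext y (v : T0) : R :=
  if unlift ord_max v is Some i then y ord0 i else - \sum_i y ord0 i.

Lemma ext_lift y i : ext y (lift ord_max i) = y ord0 i.
Proof. by rewrite /ext liftK. Qed.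

Lemma ext_max y : ext y ord_max = - \sum_i y ord0 i.
Proof. by rewrite /ext unlift_none. Qed.

Lemma sum_lift (f : T0 -> R) : \sum_v f v = \sum_i f (lift ord_max i) + f ord_max.
Proof. by rewrite (bigD1_ord ord_max)//= addrC. Qed.

Lemma sum_ext y : \sum_v ext y v = 0.
Proof.
by rewrite sum_lift ext_max; under eq_bigr do rewrite ext_lift; rewrite subrr.
Qed.

Lemma continuous_ext v : continuous (ext^~ v).
Proof.
case: (unliftP ord_max v) => [i ->|->].
  rewrite (_ : ext^~ _ = fun y => y ord0 i); first exact: continuous_coord.
  by apply/funext => y; rewrite ext_lift.
rewrite (_ : ext^~ _ = fun y => - \sum_i y ord0 i).
  exact/continuous_opp/continuous_sum/continuous_coord.
by apply/funext => y; rewrite ext_max.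
Qed.

(** Minus the smallest coordinate of [ext y]. The default 0 is harmless, as a vector of zero sum has
    a coordinate at most 0. *)
Definition depth y : R := \big[Num.max/0]_(v : T0) - ext y v.

Lemma depth_ge y v : - ext y v <= depth y.
Proof. exact: le_bigmax. Qed.

Lemma depth_eq y m : 0 <= m -> (forall v, - ext y v <= m) -> (exists v, - ext y v = m) ->
  depth y = m.
Proof.
move=> m0 ym [v vm]; apply/le_anti; rewrite -{2}vm depth_ge andbT.
by apply/bigmax_leP; split.
Qed.

Lemma depth_gt0 y : y != 0 -> 0 < depth y.
Proof.
move=> y0; rewrite lt0r andbC [0 <= _](_ : _ = true); last first.
  by rewrite /depth bigmax_idl le_max lexx.
apply: contraNneq y0 => d0; apply/eqP/rowP => i; rewrite mxE -ext_lift.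
have e0 v : 0 <= ext y v by rewrite -oppr_le0 -d0 depth_ge.
have /eqP := sum_ext y; rewrite psumr_eq0// => /allP/(_ (lift ord_max i)).
by rewrite mem_index_enum => /(_ isT)/eqP.
Qed.

Lemma continuous_depth : continuous depth.
Proof.
apply: continuous_big => [|v _]; last exact/continuous_opp/continuous_ext.
move=> x; apply: (@continuous_max R^o); [exact: cvg_fst|exact: cvg_snd].
Qed.

(* Radial projection to the boundary of the simplex from its barycenter; dividing
   by [depth y] makes the smallest coordinate vanish. *)
Definition of_sphere y : 'rV[R]_#|T0| :=
  bpoint (fun v => (depth y + ext y v) / (N * depth y)).

Lemma sphere_depth_gt0 y : @unit_sphere R n y -> 0 < depth y.
Proof.
move=> /sphereE y1; apply: depth_gt0; apply: contra_eq_neq y1 => ->.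
by rewrite eq_sym /dot big1 ?oner_eq0// => i _; rewrite !mxE mul0r.
Qed.

Lemma of_sphere_boundary y : @unit_sphere R n y ->
  geometric_realization boundary_simplex_complex (of_sphere y).
Proof.
move=> /sphere_depth_gt0 d0.
have de v : 0 <= depth y + ext y v by rewrite -lerBlDr sub0r depth_ge.
apply/realizationP; split=> [v||].
- by rewrite bcoord_point divr_ge0// mulr_ge0 ?(ltW d0)// ltW.
- under eq_bigr do rewrite bcoord_point.
  rewrite -mulr_suml big_split /= sum_ext addr0 sumr_const card_ord -mulr_natl.
  by rewrite divff// mulf_neq0// lt0r_neq0.
rewrite inE; apply/negP => /eqP sT; suff : depth y < depth y by rewrite ltxx.
rewrite {1}/depth; apply/bigmax_ltP; split=> // v _.
have : v \in supp (of_sphere y) by rewrite sT inE.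
rewrite inE bcoord_point mulf_eq0 negb_or => /andP[e0 _].
rewrite lt_neqAle depth_ge andbT; apply: contraNneq e0 => <-.
by rewrite addNr.
Qed.

Lemma of_sphere_continuous : {within @unit_sphere R n, continuous of_sphere}.
Proof.
apply: within_row => i.
rewrite (_ : (fun y => _) =
    fun y => (depth y + ext y (enum_val i)) / (N * depth y)); last first.
  by apply/funext => y; rewrite mxE.
apply: within_div => [||y yS].
- exact/continuous_add/continuous_ext/continuous_depth.
- exact/continuous_mul/continuous_depth/continuous_cst.
by rewrite mulf_neq0 ?lt0r_neq0// sphere_depth_gt0.
Qed.

Implicit Type x : 'rV[R]_#|T0|.

Definition center (x : 'rV[R]_#|T0|) : 'rV[R]_n.+1 :=
  \row_i (bcoord x (lift ord_max i) - N^-1).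

Lemma ext_center x v : geometric_realization boundary_simplex_complex x ->
  ext (center x) v = bcoord x v - N^-1.
Proof.
move=> /realizationP[_ x1 _]; case: (unliftP ord_max v) => [i ->|->].
  by rewrite ext_lift mxE.
have : \sum_v (bcoord x v - N^-1) = 0.
  by rewrite sumrB x1 sumr_const card_ord -mulr_natl mulfV ?subrr// lt0r_neq0.
rewrite sum_lift => /eqP; rewrite addr_eq0 => /eqP e; rewrite ext_max.
by apply/eqP; rewrite eqr_oppLR -e; apply/eqP/eq_bigr => i _; rewrite mxE.
Qed.

Definition radius (x : 'rV[R]_#|T0|) : R := Num.sqrt (dot (center x) (center x)).

Definition to_sphere x := (radius x)^-1 *: center x.

Lemma boundary_vertex0 x : geometric_realization boundary_simplex_complex x ->
  exists v, bcoord x v = 0.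
Proof.
move=> /realizationP[_ _]; rewrite inE -properT => /properP[_ [v _ vx]].
by exists v; exact: supp0.
Qed.

Lemma radius_gt0 x : geometric_realization boundary_simplex_complex x -> 0 < radius x.
Proof.
move=> xb; rewrite sqrtr_gt0 lt0r dot_ge0 andbT.
apply/eqP => /dot_eq0 c0; have [v xv] := boundary_vertex0 xb.
have e0 : ext 0 v = 0.
  case: (unliftP ord_max v) => [i ->|->]; rewrite ?ext_lift ?ext_max ?mxE//.
  by rewrite big1 ?oppr0// => i _; rewrite mxE.
have := ext_center v xb; rewrite xv sub0r c0 e0 => /esym/eqP.
by rewrite oppr_eq0 invr_eq0 (gt_eqF N0).
Qed.

Lemma to_sphereP x : geometric_realization boundary_simplex_complex x ->
  @unit_sphere R n (to_sphere x).
Proof.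
move=> xb; apply/sphereE; rewrite dotZl dotC dotZl mulrA -invfM -expr2.
rewrite sqr_sqrtr ?dot_ge0// mulVf// -[dot _ _]sqr_sqrtr ?dot_ge0//.
by rewrite expf_neq0// lt0r_neq0 ?radius_gt0.
Qed.

Lemma extZ a y v : ext (a *: y) v = a * ext y v.
Proof.
case: (unliftP ord_max v) => [i ->|->]; rewrite ?ext_lift ?ext_max ?mxE//.
by rewrite mulrN mulr_sumr; congr (- _); apply: eq_bigr => i _; rewrite mxE.
Qed.

Lemma to_sphereK x : geometric_realization boundary_simplex_complex x ->
  of_sphere (to_sphere x) = x.
Proof.
move=> xb; have r0 := radius_gt0 xb; have [x0 x1 _] := (realizationP _ _).1 xb.
(* A boundary point has a zero coordinate, so the smallest centered coordinate is exactly
   [- N^-1]. *)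
have dE : depth (to_sphere x) = (radius x)^-1 * N^-1.
  apply: depth_eq => [|v|]; first by rewrite mulr_ge0 ?invr_ge0 ?ltW.
    rewrite extZ ext_center// -mulrN ler_pM2l ?invr_gt0//.
    by rewrite opprB gerBl.
  have [v xv] := boundary_vertex0 xb; exists v.
  by rewrite extZ ext_center// xv sub0r mulrN opprK.
apply: bcoordP => v; rewrite bcoord_point dE extZ ext_center//.
by field; rewrite !lt0r_neq0.
Qed.

Lemma continuous_center i : continuous (fun x => center x ord0 i).
Proof.
rewrite (_ : (fun x => _) = fun x => bcoord x (lift ord_max i) - N^-1); last first.
  by apply/funext => x; rewrite mxE.
exact/continuous_add/continuous_cst/continuous_bcoord.
Qed.

Lemma to_sphere_continuous :
  {within geometric_realization boundary_simplex_complex, continuous to_sphere}.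
Proof.
apply: within_row => i.
rewrite (_ : (fun x => _) = fun x => center x ord0 i / radius x); last first.
  by apply/funext => x; rewrite mxE mulrC.
apply: within_div => [||x xb]; first exact: continuous_center.
  move=> x; apply: continuous_comp; last exact: sqrt_continuous.
  by apply: continuous_dot; exact: continuous_center.
by rewrite lt0r_neq0 ?radius_gt0.
Qed.

End SphereMaps.

Section SphereCohomology.
Variables (R : realType) (F : fieldType) (n : nat).
Local Open Scope classical_set_scope.
Local Open Scope ring_scope.

(** The indicator of the facet opposite [ord0] is closed for lack of simplices of higher dimension.
    All faces of the full sequence lie in the complex, so a primitive [b] would have a double
    coboundary equal to 1 there. *)
Lemma boundary_simplex_acyclicN : ~ acyclic F (simplices (boundary_simplex_complex n)) n.
Proof.
have cB := boundary_simplex_complexP n.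
move=> /(acyclic_increasing F n (@ord_inj n.+2) (simplices_sub cB)) acyc.
pose t := behead (enum 'I_n.+2).
have tE : enum 'I_n.+2 = ord0 :: t by rewrite /t enum_ordSl.
have t0 : ord0 \notin t.
  by have := enum_uniq 'I_n.+2; rewrite tE /= => /andP[].
have st : size (ord0 :: t) = n.+2 by rewrite -tE size_enum_ord.
have incE : increasing (@nat_of_ord n.+2) (ord0 :: t).
  by rewrite -tE; have := iota_ltn_sorted 0 n.+2; rewrite -val_enum_ord sorted_map.
have [|b bP] := acyc (fun s => (s == t)%:R : F).
  move=> s [sB si] sn; exfalso; move: sB.
  rewrite /simplices inE => /eqP; apply; apply/eqP.
  rewrite eqEcard finset.subsetT cardsT card_ord cardsE.
  by rewrite (card_uniqP (increasing_uniq si)) sn leqnn.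
have := cob_cob b (ord0 :: t).
rewrite -(eq_cob (c := fun s => (s == t)%:R)) => [/=|u us].
  rewrite eqxx (eq_cob (d := fun=> 0)) => [|u _].
    by rewrite cob0 subr0 => /eqP; rewrite oner_eq0.
  by case: eqVneq => // uE; move: t0; rewrite -uE mem_head.
apply: bP; last by move: st; rewrite (face_size us) => -[].
split; last exact: increasing_face incE us.
rewrite /simplices inE; apply/negP => /eqP uT.
have := card_size u; rewrite -cardsE uT cardsT card_ord.
by move: st; rewrite (face_size us) => -[->]; rewrite ltnn.
Qed.

Variables (T : finType) (K : {set {set T}}).
Hypothesis sphereK : sphere_triangulation R n K.

(** The identity of the boundary of the simplex factors through [K] by way of the sphere, so
    acyclicity of [K] would pass to that boundary. *)
Lemma sphere_acyclicN : ~ acyclic F (simplices K) n.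
Proof.
case: sphereK => cK [f [g [[cf cg] fS gK gf fg]]] acyc.
apply: boundary_simplex_acyclicN => c cc.
have cB := boundary_simplex_complexP n.
apply: (coboundary_factor cB cB cK (subxx _) (a := fun x => g (to_sphere x))
  (b := fun x => of_sphere (f x)) _ _ _ _ _ acyc cc).
- by move=> x /to_sphereP; exact: gK.
- by move=> x /fS; exact: of_sphere_boundary.
- by move=> x xB; rewrite fg ?to_sphereK//; exact: to_sphereP.
- apply: close_continuous_within => //.
  by apply: within_comp cg; [exact: to_sphereP|exact: to_sphere_continuous].
apply: close_continuous_within => //.
by apply: within_comp (@of_sphere_continuous R n).
Qed.

End SphereCohomology.

(** * Stereographic projection from a point of the sphere *)

Section Stereographic.
Variables (R : realType) (n : nat) (p : 'rV[R]_n.+1).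
Local Open Scope classical_set_scope.
Local Open Scope ring_scope.
Hypothesis pS : dot p p = 1.

Definition stereo (y : 'rV[R]_n.+1) := (1 - dot y p)^-1 *: (y - dot y p *: p).

(* The projection of [w] to the hyperplane orthogonal to [p] comes first, so that
   the inverse of the stereographic projection is defined on the whole space. *)
Definition unstereo (w : 'rV[R]_n.+1) :=
  let w' := w - dot w p *: p in
  (dot w' w' + 1)^-1 *: (2 *: w' + (dot w' w' - 1) *: p).

Lemma dot_eq1 y : dot y y = 1 -> dot y p = 1 -> y = p.
Proof.
move=> yS yp; apply/eqP; rewrite -subr_eq0; apply/eqP/dot_eq0.
rewrite (_ : y - p = 1 *: y + (-1) *: p); last by rewrite scale1r scaleN1r.
by rewrite dot_comb yS yp pS; ring.
Qed.

Lemma unstereo_sphere w : dot (unstereo w) (unstereo w) = 1.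
Proof.
rewrite /unstereo; set w' := w - _.
have wp : dot w' p = 0 by rewrite dotBl dotZl pS mulr1 subrr.
have s0 := dot_ge0 w'.
rewrite dotZl dotC dotZl dot_comb wp pS.
by field; rewrite lt0r_neq0// ltr_wpDl.
Qed.

Lemma stereoK y : dot y y = 1 -> dot y p != 1 -> unstereo (stereo y) = y.
Proof.
move=> yS yp; have d0 : 1 - dot y p != 0 by rewrite subr_eq0 eq_sym.
have sp : dot (stereo y) p = 0 by rewrite /stereo dotZl dotBl dotZl pS mulr1 subrr mulr0.
have s1 : dot (stereo y) (stereo y) = (1 + dot y p) / (1 - dot y p).
  rewrite /stereo dotZl [dot _ (_ *: _)]dotC dotZl.
  rewrite (_ : y - _ = 1 *: y + (- dot y p) *: p); last by rewrite scale1r scaleNr.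
  rewrite dot_comb yS pS.
  by field.
rewrite /unstereo sp scale0r subr0 s1 /stereo.
have d2 : (1 + dot y p) / (1 - dot y p) + 1 = 2 / (1 - dot y p) by field.
rewrite d2; apply/rowP => i; rewrite !mxE.
by field.
Qed.

Lemma continuous_unstereo (X : topologicalType) (A : set X) (f : X -> 'rV[R]_n.+1) :
  (forall i, continuous (fun x => f x ord0 i)) ->
  {within A, continuous (fun x => unstereo (f x))}.
Proof.
move=> cf; pose w' x := f x - dot (f x) p *: p.
have cw i : continuous (fun x => w' x ord0 i).
  rewrite (_ : (fun x => _) = fun x => f x ord0 i + - (dot (f x) p * p ord0 i)).
    apply: continuous_add => //; apply/continuous_opp/continuous_mul/continuous_cst.
    by apply: continuous_dot => // j; exact: continuous_cst.
  by apply/funext => x; rewrite !mxE.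
apply: within_row => i.
rewrite (_ : (fun x => _) = fun x =>
   (2 * w' x ord0 i + (dot (w' x) (w' x) + - 1) * p ord0 i) / (dot (w' x) (w' x) + 1)).
  apply: within_div => [||x _].
  - apply: continuous_add; first exact/continuous_mul/cw/continuous_cst.
    apply: continuous_mul; last exact: continuous_cst.
    exact/continuous_add/continuous_cst/continuous_dot.
  - exact/continuous_add/continuous_cst/continuous_dot.
  - by rewrite lt0r_neq0// ltr_wpDl// dot_ge0.
by apply/funext => x; rewrite /unstereo -/(w' x) !mxE mulrC.
Qed.

Lemma continuous_stereo (A : set 'rV[R]_n.+1) : (forall y, A y -> dot y p != 1) ->
  {within A, continuous stereo}.
Proof.
move=> A1; have cd : continuous (fun y => dot y p).
  by apply: continuous_dot => i; [exact: continuous_coord|exact: continuous_cst].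
apply: within_row => i.
rewrite (_ : (fun y => _) = fun y : 'rV[R]_n.+1 =>
   (y ord0 i + - (dot y p * p ord0 i)) / (1 + - dot y p)).
  apply: within_div => [||y Ay].
  - apply: continuous_add; first exact: continuous_coord.
    by apply: continuous_opp; apply: continuous_mul => //; exact: continuous_cst.
  - by apply: continuous_add; [exact: continuous_cst|exact: continuous_opp].
  - by rewrite subr_eq0 eq_sym A1.
by apply/funext => y; rewrite !mxE mulrC.
Qed.

End Stereographic.

(** * A cube placed affinely in a full simplex *)

Section BigSimplex.
Variables (R : realType) (n : nat) (r : R).
Local Open Scope classical_set_scope.
Local Open Scope ring_scope.
Hypothesis r0 : 0 < r.
Let T0 : finType := 'I_n.+2.

(** On the cube of half-side [r] each of the [n + 1] values [inner w i] is at most [2 * c], so that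
    their sum is at most 1. *)
Let c : R := (2 * n.+1%:R)^-1.
Let c0 : 0 < c. Proof. by rewrite invr_gt0 mulr_gt0 ?ltr0n. Qed.

Let inner (w : 'rV[R]_n.+1) i : R := c * (1 + w ord0 i / r).

Definition to_simplex (w : 'rV[R]_n.+1) : 'rV[R]_#|T0| :=
  bpoint (fun v => if unlift ord_max v is Some i then inner w i
                   else 1 - \sum_i inner w i).

Definition of_simplex (x : 'rV[R]_#|T0|) : 'rV[R]_n.+1 :=
  \row_i (r * (bcoord x (lift ord_max i) * c^-1 + - 1)).

Lemma to_simplexK w : of_simplex (to_simplex w) = w.
Proof.
apply/rowP => i; rewrite mxE bcoord_point liftK /inner.
by field; rewrite !lt0r_neq0.
Qed.

Lemma to_simplexP (w : 'rV[R]_n.+1) : (forall i, `|w ord0 i| <= r) ->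
  geometric_realization [set: {set T0}]%SET (to_simplex w).
Proof.
move=> wr.
have in0 i : 0 <= inner w i <= c * 2.
  have : -1 <= w ord0 i / r <= 1.
    rewrite ler_pdivlMr// ler_pdivrMr// mulN1r mul1r -ler_norml; exact: wr.
  case/andP => *; rewrite mulr_ge0 ?(ltW c0)//=; last by lra.
  by rewrite ler_pM2l//; lra.
apply/realizationP; split=> [v||]; last by rewrite inE.
  rewrite bcoord_point; case: (unlift _ _) => [i|]; first by case/andP: (in0 i).
  rewrite subr_ge0.
  have -> : (1 : R) = \sum_(i < n.+1) c * 2.
    rewrite sumr_const card_ord -[RHS]mulr_natr /c.
    by field; rewrite nat1r pnatr_eq0.
  by apply: ler_sum => i _; case/andP: (in0 i).
rewrite sum_lift (eq_bigr (inner w)) => [|i _]; last by rewrite bcoord_point liftK.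
by rewrite bcoord_point unlift_none addrC subrK.
Qed.

Lemma continuous_to_simplex : {within setT, continuous to_simplex}.
Proof.
have cin i : continuous (inner^~ i).
  apply: continuous_mul; first exact: continuous_cst.
  apply: continuous_add; first exact: continuous_cst.
  by apply: continuous_mul; [exact: continuous_coord|exact: continuous_cst].
apply: within_row => j; apply: continuous_subspaceT.
rewrite (_ : (fun w => _) = fun w : 'rV[R]_n.+1 => if unlift ord_max (enum_val j) is Some i
    then inner w i else 1 + - \sum_i inner w i); last first.
  by apply/funext => w; rewrite mxE.
case: (unlift _ _) => [i|]; first exact: cin.
apply: continuous_add; first exact: continuous_cst.
exact/continuous_opp/continuous_sum.
Qed.

Lemma continuous_of_simplex i : continuous (fun x => of_simplex x ord0 i).
Proof.
rewrite (_ : (fun x => _) = fun x => r * (bcoord x (lift ord_max i) * c^-1 + - 1)).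
  apply: continuous_mul; first exact: continuous_cst.
  apply: continuous_add; last exact: continuous_cst.
  by apply: continuous_mul; [exact: continuous_bcoord|exact: continuous_cst].
by apply/funext => x; rewrite mxE.
Qed.

End BigSimplex.

Lemma full_simplex_acyclic (F : fieldType) (T : finType) (v : T) k :
  acyclic F (simplices [set: {set T}]%SET) k.
Proof.
move=> c cc; exists (cone v c) => s _ sk.
by rewrite -[LHS](coneP v) /cone cc ?addr0 ?/simplices ?inE//= sk.
Qed.

(** * A triangulated sphere without a vertex *)

Section Puncture.
Variables (R : realType) (F : fieldType) (n : nat) (T : finType) (K : {set {set T}}).
Local Open Scope classical_set_scope.
Local Open Scope ring_scope.
Hypothesis sphereK : sphere_triangulation R n K.

(** Simplices without [v] realize a compact set missing the point [v]. Stereographic projection from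
    the image of [v] is bounded on it, so the set maps into a full simplex and back to [K] with
    composite the inclusion. *)
Lemma sphere_puncture (v : T) (c : seq T -> F) : [set v]%SET \in K ->
  cocycle (simplices K) n c ->
  coboundary (simplices [set s in K | v \notin s]%SET) n c.
Proof.
case: sphereK => cK [f [g [[cf cg] fS gK gf fg]]] vK cc.
set L := [set s in K | v \notin s]%SET.
have LK : (L \subset K)%SET by apply/fintype.subsetP => s; rewrite inE => /andP[].
have cL : simplicial_complex L.
  split=> [|s t]; first by rewrite !inE cK.1.
  rewrite !inE => /andP[sK vs] ts; rewrite (cK.2 _ _ sK ts)/=.
  by apply: contra vs => /(fintype.subsetP ts).
have LKr (x : 'rV[R]_#|T|) : geometric_realization L x -> geometric_realization K x.
  move=> /realizationP[x0 x1 xL]; apply/realizationP; split=> //.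
  exact: (fintype.subsetP LK).
pose x0 : 'rV[R]_#|T| := bpoint (fun u => (u == v)%:R).
have x0K : geometric_realization K x0.
  apply/realizationP; split=> [u||]; first by rewrite bcoord_point.
    under eq_bigr do rewrite bcoord_point.
    by rewrite (bigD1 v)//= eqxx big1 ?addr0// => u /negPf ->.
  rewrite (_ : supp x0 = [set v]%SET)//; apply/setP => u.
  by rewrite !inE bcoord_point pnatr_eq0 eqb0 negbK.
pose p := f x0; have pS : dot p p = 1 by apply/sphereE/fS.
have fp x : geometric_realization L x -> dot (f x) p != 1.
  move=> xL; apply/negP => /eqP fx1.
  have fxp : f x = p by apply: dot_eq1 => //; apply/sphereE/fS/LKr.
  have xx0 : x = x0 by rewrite -(gf x (LKr x xL)) fxp gf.
  have /realizationP[_ _] := xL; rewrite inE => /andP[_].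
  by rewrite inE negbK xx0 bcoord_point eqxx oner_eq0.
have cfL : {within geometric_realization L, continuous f}.
  exact: continuous_subspaceW cf.
have csf : {within geometric_realization L, continuous (fun x => stereo p (f x))}.
  apply: (within_comp (B := [set y | dot y p != 1])) => //.
  exact: continuous_stereo.
have [r r0 rP] : exists2 r : R, 0 < r & forall x, geometric_realization L x ->
    forall i, `|stereo p (f x) ord0 i| <= r.
  have cd : {within geometric_realization L, continuous
      (fun x => dot (stereo p (f x)) (stereo p (f x)) : R^o)}.
    apply: (within_comp (B := setT) (g := fun w => dot w w : R^o)) => //.
    by apply: continuous_subspaceT; apply: continuous_dot => i; exact: continuous_coord.
  have := continuous_compact cd (realization_compact cL).
  move=> /compact_bounded[M [_ MP]].
  have {}MP x : geometric_realization L x ->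
      dot (stereo p (f x)) (stereo p (f x)) <= `|M| + 1.
    move=> xL; apply: le_trans (ler_norm _) _; apply: (MP (`|M| + 1)).
      by rewrite (le_lt_trans (ler_norm M))// ltrDl.
    by exists x.
  (* The bound comes from [|w| <= w^2 + 1], which avoids a square root. *)
  exists (`|M| + 2) => [|x xL i]; first by rewrite ltr_wpDl.
  have := MP x xL; rewrite /dot (bigD1 i)//=.
  set w := stereo _ _ _ _; set S := (\sum_(_ | _) _).
  have S0 : 0 <= S by apply: sumr_ge0 => j _; rewrite -expr2 sqr_ge0.
  move: `|M| => B wB; rewrite ler_norml; apply/andP; split; nra.
have cM : simplicial_complex [set: {set 'I_n.+2}]%SET by split=> *; rewrite inE.
apply: (coboundary_factor cL cK cM LK (a := fun x => to_simplex r (stereo p (f x)))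
  (b := fun x => g (unstereo p (of_simplex r x))) _ _ _ _ _
  (full_simplex_acyclic (ord0 : 'I_n.+2) (k := n)) cc).
- by move=> x xL; apply: to_simplexP => //; exact: rP.
- by move=> x _; apply/gK/sphereE/unstereo_sphere.
- move=> x xL; have xK := LKr x xL.
  by rewrite to_simplexK// stereoK ?gf//; [apply/sphereE/fS|exact: fp].
- apply: close_continuous_within => //.
  by apply: (within_comp (B := setT)) => //; exact: continuous_to_simplex.
apply: close_continuous_within => //.
apply: within_comp cg => [x _|]; first exact/sphereE/unstereo_sphere.
exact/continuous_unstereo/continuous_of_simplex.
Qed.

End Puncture.

(** * Rainbow simplices *)

Section Partition.
Variables (T : finType) (n : nat) (K : {set {set T}}) (V : 'I_n.+1 -> {set T}).
Hypotheses (cK : simplicial_complex K) (partV : vertex_partition K V).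

Lemma partition_cover v : [set v]%SET \in K -> exists i, v \in V i.
Proof.
case: partV => _ _ covV vK; have : v \in vertices K by rewrite inE.
by rewrite -covV => /finset.bigcupP[i _ vi]; exists i.
Qed.

Lemma partition_inj i j v : v \in V i -> v \in V j -> i = j.
Proof.
case: partV => _ disV _ vi vj; apply/eqP/negPn/negP => /disV.
by rewrite disjoint_subset => /fintype.subsetP/(_ v vi); rewrite inE vj.
Qed.

(** One vertex of each colour chosen in a simplex that meets all of them spans a rainbow face. *)
Lemma missing_color s : ~ (exists t, rainbow_simplex K V t) -> simplices K s ->
  exists i, forall v, v \in s -> v \notin V i.
Proof.
move=> noV sK; apply: contrapT => nomiss; apply: noV.
have /choice[f fP] i : exists v, (v \in s) && (v \in V i).
  apply: contrapT => noi; apply: nomiss; exists i => v vs.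
  by apply/negP => vi; apply: noi; exists v; rewrite vs.
have fs i : f i \in s by case/andP: (fP i).
have fV i : f i \in V i by case/andP: (fP i).
have f_inj : injective f by move=> i j fij; apply: partition_inj (fV i) _; rewrite fij.
exists [set f i | i : 'I_n.+1]%SET; split=> [||i].
- by apply: cK.2 sK _; apply/fintype.subsetP => _ /imsetP[i _ ->]; rewrite inE.
- by rewrite card_imset// card_ord.
rewrite (_ : _ :&: _ = [set f i])%SET ?cards1//; apply/setP => v; rewrite !inE.
apply/andP/eqP => [[/imsetP[j _ ->] vi]|->].
  by rewrite (partition_inj (fV j) vi).
by split=> //; apply: imset_f.
Qed.

Lemma avoiding_induced I :
  avoiding K V I = simplices (induced K (\bigcup_(i in ~: [set i in I]) V i)%SET).
Proof.
apply/funext => s; apply/propext; rewrite /simplices inE.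
split=> [[sK sI]|/andP[sK /fintype.subsetP sU]].
  rewrite sK; apply/fintype.subsetP => v; rewrite inE => vs.
  have [|i vi] := @partition_cover v.
    by apply: cK.2 sK _; rewrite finset.sub1set inE.
  apply/finset.bigcupP; exists i => //; rewrite !inE.
  by apply/negP => /sI/(_ vs); rewrite vi.
split=> // i v iI vs; apply/negP => vi.
have /finset.bigcupP[j] : v \in (\bigcup_(i in ~: [set i in I]) V i)%SET.
  by apply: sU; rewrite inE.
by rewrite !inE => + vj; rewrite (partition_inj vj vi) iI.
Qed.

End Partition.

Lemma induced_complex (T : finType) (K : {set {set T}}) U :
  simplicial_complex K -> simplicial_complex (induced K U).
Proof.
move=> cK; split=> [|s t]; first by rewrite inE cK.1 finset.sub0set.
rewrite !inE => /andP[sK sU] ts; rewrite (cK.2 _ _ sK ts)/=.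
exact: fintype.subset_trans ts sU.
Qed.

Theorem theorem5 (R : realType) (F : fieldType) (T : finType) (n : nat)
    (K : {set {set T}}) (V : 'I_n.+1 -> {set T}) :
  sphere_triangulation R n K ->
  vertex_partition K V ->
  (forall S : {set 'I_n.+1}, (1 <= #|S|)%N -> (#|S| <= n - 1)%N ->
     forall h : reduced_homology F (induced K (\bigcup_(i in S) V i)) #|S|,
       h = 0%R) ->
  exists s : {set T}, rainbow_simplex K V s.
Proof.
move=> sphereK partV h0; apply: contrapT => noV.
have cK := sphereK.1.
apply: (sphere_acyclicN (F := F) sphereK).
apply: (acyclic_of_columns (V := V) cK).
- by move=> s; exact: missing_color.
- exact: partition_cover.
- move=> I k iI I2 k1 Ik; rewrite (avoiding_induced cK partV).
  (* The hypothesis is applied to the complement of [I]; two deleted colours at least means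
     [|S| <= n - 1]. *)
  have kE : #|~: [set i in I]%SET| = k.
    have := cardsC [set i in I]%SET.
    rewrite cardsE (card_uniqP (increasing_uniq iI)) card_ord => IE.
    by apply/eqP; rewrite -(eqn_add2l (size I)) IE Ik.
  rewrite -kE; apply: acyclic_of_homology; first exact: induced_complex.
  by apply: h0; rewrite kE//; lia.
(* A single deleted colour: its block contains a vertex [v], and simplices avoiding the colour avoid
   [v]. *)
move=> i c cc; have [/(_ i)/finset.set0Pn[v vi] _ covV] := partV.
have vK : [set v]%SET \in K.
  have : v \in vertices K by rewrite -covV; apply/finset.bigcupP; exists i.
  by rewrite inE.
have [b bP] := sphere_puncture sphereK vK cc.
exists b => s [sK sV] sn; apply: bP => //.
rewrite /simplices inE sK inE; apply/negP => vs.
by have := sV i v (mem_head _ _) vs; rewrite vi.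
Qed.
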